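(* Let $s\in(0,1)$, $p\in(1,+\infty)$, $N\geqslant1$, and let $\Omega\subset\mathbb{R}^N$ be a bounded open set. Let $\lambda_2$ be the second eigenvalue of the fractional Dirichlet $p$-Laplacian in $\Omega$. Assume that there exists a function $v\in\widetilde{W}_0^{s,p}(\Omega)$ such that $v^\pm\not\equiv0$ in $\Omega$ and $$\lambda_2\int_\Omega|v^+|^p\,dx\geqslant\frac1p\langle D[v]_p^p,v^+\rangle\quad\text{and}\quad\lambda_2\int_\Omega|v^-|^p\,dx\geqslant\frac1p\langle D[v]_p^p,v^-\rangle.$$ Then $v$ is a second eigenfunction and equalities hold in both of these inequalities.
   Context: $\|\cdot\|_p$ is the norm of $L^p(\mathbb{R}^N)$, $[u]_p=\left(\int_{\mathbb{R}^N}\int_{\mathbb{R}^N}\frac{|u(x)-u(y)|^p}{|x-y|^{N+ps}}\,dx\,dy\right)^{1/p}$, $W^{s,p}(\mathbb{R}^N)=\{u\in L^p(\mathbb{R}^N):[u]_p<+\infty\}$. $\widetilde{W}_0^{s,p}(\Omega)$ is the completion of $C_0^\infty(\Omega)$ (functions extended by zero to $\mathbb{R}^N$) with respect to the norm $\|\cdot\|_p+[\cdot]_p$. For $u,\xi\in W^{s,p}(\mathbb{R}^N)$, $$\langle D[u]_p^p,\xi\rangle=p\int_{\mathbb{R}^N}\int_{\mathbb{R}^N}\frac{|u(x)-u(y)|^{p-2}(u(x)-u(y))(\xi(x)-\xi(y))}{|x-y|^{N+ps}}\,dx\,dy.$$ $v^+=\max\{v,0\}$, $v^-=\min\{v,0\}$.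 Let $\mathcal{S}=\{u\in\widetilde{W}_0^{s,p}(\Omega):\|u\|_p=1\}$, let $S^1$ be a circle in $\mathbb{R}^2$, and let $\mathcal{G}_2$ be the family of all $\mathcal{A}\subset\mathcal{S}$ for which there is a continuous odd surjection $h:S^1\to\mathcal{A}$. Then $\lambda_2=\inf_{\mathcal{A}\in\mathcal{G}_2}\sup_{u\in\mathcal{A}}[u]_p^p$. A second eigenfunction is a nonzero $u\in\widetilde{W}_0^{s,p}(\Omega)$ such that $\frac1p\langle D[u]_p^p,\xi\rangle=\lambda_2\int_\Omega|u|^{p-2}u\,\xi\,dx$ for all $\xi\in\widetilde{W}_0^{s,p}(\Omega)$. *)

(* Defs.v *)
From HB Require Import structures.
From mathcomp Require Import all_boot all_order all_algebra.
From mathcomp Require Import all_classical all_reals all_analysis measurable_realfun.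

Set Implicit Arguments.
Unset Strict Implicit.
Unset Printing Implicit Defensive.

Import Order.TTheory GRing.Theory Num.Theory.
Import numFieldNormedType.Exports.

Local Open Scope classical_set_scope.
Local Open Scope ring_scope.

Definition rV_display : measure_display.
Proof. exact: default_measure_display. Qed.

Section rV_borel.
Context (R : realType) (n : nat).

Let borel : set (set 'rV[R]_n) := <<s [set A : set 'rV[R]_n | open A] >>.

Let borel0 : borel set0. Proof. exact: sigma_algebra0. Qed.

Let borelC A : borel A -> borel (~` A). Proof. exact: sigma_algebraC. Qed.

Let borel_bigcup (F : (set 'rV[R]_n)^nat) :
  (forall i, borel (F i)) -> borel (\bigcup_i F i).
Proof. exact: sigma_algebra_bigcup. Qed.

HB.instance Definition _ := @isMeasurable.Build rV_display
  'rV[R]_n borel borel0 borelC borel_bigcup.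

Lemma measurable_rV_open (A : set 'rV[R]_n) : open A -> measurable A.
Proof. by move=> oA; exact: sub_sigma_algebra. Qed.

Lemma measurable_rV_coord (i : 'I_n) :
  measurable_fun setT (fun x : 'rV[R]_n => x 0 i).
Proof.
apply: (measurability _ (RGenOpens.measurableE R)).
move=> _ [_ [a [b ->] <-]]; rewrite setTI; apply: measurable_rV_open.
have := @coord_continuous R 1 n 0 i.
by move/continuousP; apply; exact: interval_open.
Qed.

(* every open set is a countable union of rational cubes *)
Lemma measurable_fun_rVP d (T : measurableType d) (f : T -> 'rV[R]_n) :
  (forall i, measurable_fun setT (fun t => f t 0 i)) -> measurable_fun setT f.
Proof.
move=> mf.
have mball (c : 'rV[rat]_n) (k : nat) :
    measurable (f @^-1` [set x | forall i, `|x 0 i - ratr (c 0 i)| < k.+1%:R^-1]).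
  rewrite (_ : f @^-1` _ = \bigcap_(i in [set: 'I_n])
      [set t | `|f t 0 i - ratr (c 0 i)| < k.+1%:R^-1]); last first.
    apply/seteqP; split => [t ct i _|t ct i]; first exact: ct.
    exact: (ct i).
  apply: fin_bigcap_measurable => [|i _]; first exact: finite_finset.
  have := mf i measurableT (ball (ratr (c 0 i) : R) k.+1%:R^-1).
  rewrite setTI => /(_ (open_measurable _)).
  rewrite (_ : _ @^-1` _ = [set t | `|f t 0 i - ratr (c 0 i)| < k.+1%:R^-1]).
    by apply; exact: ball_open.
  by apply/funext => t; rewrite /preimage /ball/= distrC.
apply: (@measurability _ _ _ _ setT f [set A : set 'rV[R]_n | open A]) => //.
move=> _ [U oU <-]; rewrite setTI.
pose C (q : 'rV[rat]_n * nat) : set 'rV[R]_n :=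
  [set x | forall i, `|x 0 i - ratr (q.1 0 i)| < q.2.+1%:R^-1].
have -> : U = \bigcup_(q in [set q | C q `<=` U]) C q.
  apply/seteqP; split => [x Ux|x [q /= + Cx]]; last exact.
  have /nbhs_ballP[e /= e0 eU] : nbhs x U by exact: open_nbhs_nbhs.
  have [k ke] : exists k : nat, k.+1%:R^-1 < e / 2.
    have e20 : 0 < e / 2 by rewrite divr_gt0.
    have [k _ /(_ _ (leqnn k))] := near_infty_natSinv_lt (PosNum e20).
    by exists k.
  have /choice[c cx] : forall i : 'I_n, exists q : rat,
      `|x 0 i - ratr q| < k.+1%:R^-1.
    move=> i.
    have /rat_in_itvoo[q] : x 0 i - k.+1%:R^-1 < x 0 i + k.+1%:R^-1 :> R.
      by rewrite ltrBlDr -addrA ltrDl addr_gt0// invr_gt0.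
    rewrite in_itv/= => /andP[q1 q2]; exists q.
    by rewrite distrC ltr_distl q1 q2.
  exists (\row_i c i, k) => [y /= Cy|i /=]; last by rewrite mxE.
  apply: eU; split=> // i j; rewrite ord1 /ball/=.
  have := Cy j; rewrite mxE => yj.
  rewrite (le_lt_trans (ler_distD (ratr (c j)) _ _))//.
  rewrite (splitr e) ltrD//.
    exact: lt_trans (cx j) ke.
  by rewrite distrC; exact: lt_trans yj ke.
rewrite preimage_bigcup; rewrite bigcup_mkcond; apply: countable_bigcupT_measurable => [|[c k]]; first exact: countableP.
by case: ifPn => // _; exact: mball.
Qed.

End rV_borel.

Section lebesgue_step.
Context (R : realType) (n : nat).
Variable mu : {sigma_finite_measure set 'rV[R]_n -> \bar R}.

Definition rV_cons (z : R * 'rV[R]_n) : 'rV[R]_n.+1 :=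
  \row_i oapp (z.2 0) z.1 (unlift 0 i).

Definition rV_uncons (x : 'rV[R]_n.+1) : R * 'rV[R]_n :=
  (x 0 0, \row_i x 0 (lift 0 i)).

Lemma rV_consK : cancel rV_cons rV_uncons.
Proof.
move=> [a y]; rewrite /rV_cons /rV_uncons; congr pair.
  by rewrite mxE unlift_none.
by apply/rowP => i; rewrite !mxE liftK.
Qed.

Lemma measurable_rV_cons :
  measurable_fun setT (rV_cons : measurableTypeR R * 'rV[R]_n -> 'rV[R]_n.+1).
Proof.
apply: measurable_fun_rVP => i; rewrite /rV_cons.
under eq_fun do rewrite mxE.
case: unliftP => [j _|_] /=; last exact: measurable_fst.
apply: (@measurableT_comp _ _ _ _ _ _ (fun x : 'rV[R]_n => x 0 j) _ snd) => //.
exact: measurable_rV_coord.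
Qed.

Lemma measurable_rV_uncons :
  measurable_fun setT (rV_uncons : 'rV[R]_n.+1 -> measurableTypeR R * 'rV[R]_n).
Proof.
apply/measurable_fun_pair => /=; first exact: measurable_rV_coord.
apply: measurable_fun_rVP => i; under eq_fun do rewrite mxE.
exact: measurable_rV_coord.
Qed.

Let prod : {measure set (measurableTypeR R * 'rV[R]_n)%type -> \bar R} :=
  (@lebesgue_measure R \x mu)%E.

Definition lebesgue_rV_step : set 'rV[R]_n.+1 -> \bar R :=
  pushforward (@lebesgue_measure R \x mu)%E rV_cons.

Let mpre (A : set 'rV[R]_n.+1) : measurable A -> measurable (rV_cons @^-1` A).
Proof.
by move=> mA; rewrite -[X in measurable X]setTI; exact: measurable_rV_cons.
Qed.

Let step0 : lebesgue_rV_step set0 = 0%E.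
Proof. by rewrite /lebesgue_rV_step /pushforward preimage_set0 measure0. Qed.

Let step_ge0 A : (0 <= lebesgue_rV_step A)%E.
Proof. exact: (measure_ge0 prod). Qed.

Let step_sigma_additive : semi_sigma_additive lebesgue_rV_step.
Proof.
move=> F mF tF mUF; rewrite /lebesgue_rV_step /pushforward preimage_bigcup.
apply: (@measure_semi_sigma_additive _ _ _ prod).
- by move=> k; exact: mpre.
- apply/trivIsetP => i j _ _ ij; rewrite -preimage_setI.
  by move/trivIsetP : tF => ->//; rewrite preimage_set0.
- by rewrite -preimage_bigcup; exact: mpre.
Qed.

HB.instance Definition _ := isMeasure.Build _ _ _ lebesgue_rV_step
  step0 step_ge0 step_sigma_additive.

Lemma lebesgue_rV_step_sigma_finite : sigma_finite setT lebesgue_rV_step.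
Proof.
have /sigma_finiteP[F [TF ndF Foo]] := sigma_finiteT (@lebesgue_measure R).
have /sigma_finiteP[G [TG ndG Goo]] := sigma_finiteT mu.
exists (fun k => rV_uncons @^-1` (F k `*` G k)).
  apply/seteqP; split => // x _.
  have [i _ Fi] : (\bigcup_k F k) (rV_uncons x).1 by rewrite -TF.
  have [j _ Gj] : (\bigcup_k G k) (rV_uncons x).2 by rewrite -TG.
  exists (maxn i j) => //; split.
    by move: Fi; exact/subsetPset/ndF/leq_maxl.
  by move: Gj; exact/subsetPset/ndG/leq_maxr.
move=> k; have [mF Fk] := Foo k; have [mG Gk] := Goo k.
split.
  rewrite -[X in measurable X]setTI.
  by apply: measurable_rV_uncons => //; exact: measurableX.
rewrite /lebesgue_rV_step /pushforward -comp_preimage.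
rewrite (_ : rV_uncons \o rV_cons = id); last exact/funext/rV_consK.
rewrite preimage_id product_measure1E//.
by rewrite lte_mul_pinfty// ge0_fin_numE.
Qed.

HB.instance Definition _ := Measure_isSigmaFinite.Build _ _ _ lebesgue_rV_step
  lebesgue_rV_step_sigma_finite.

End lebesgue_step.

Fixpoint lebesgue_rV (R : realType) (n : nat) :
    {sigma_finite_measure set 'rV[R]_n -> \bar R} :=
  match n with
  | 0 => dirac (0 : 'rV[R]_0)
  | m.+1 => lebesgue_rV_step (lebesgue_rV R m)
  end.

Lemma lebesgue_rV_box (R : realType) (n : nat)
    (A : 'I_n -> set (measurableTypeR R)) : (forall i, measurable (A i)) ->
  lebesgue_rV R n [set x : 'rV[R]_n | forall i, A i (x 0 i)] =
  (\prod_(i < n) lebesgue_measure (A i))%E.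
Proof.
elim: n => [|n IH] in A *; move=> mA.
  rewrite big_ord0 /= diracE mem_set//= => -[].
  by case.
rewrite big_ord_recl /= /lebesgue_rV_step /pushforward.
rewrite -(IH (fun i => A (lift 0 i)))//.
rewrite -product_measure1E//; last first.
  rewrite (_ : [set _ | _] = \bigcap_(i in [set: 'I_n])
      ((fun x : 'rV[R]_n => x 0 i) @^-1` A (lift 0 i))); last first.
    by apply/seteqP; split => [x Ax i _|x Ax i]; exact: Ax.
  apply: fin_bigcap_measurable => [|i _]; first exact: finite_finset.
  rewrite -[X in measurable X]setTI.
  exact: (@measurable_rV_coord R n i measurableT _ (mA _)).
congr ((_ \x _)%E _); apply/seteqP; split => [z /= Az|z [/= A0 Az] i].
  split => [|i /=]; first by have := Az ord0; rewrite mxE unlift_none.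
  by have := Az (lift 0 i); rewrite mxE liftK.
by rewrite mxE; case: unliftP => [j ->|->] /=.
Qed.

Section fractional_sobolev.
Context (R : realType) (N : nat).
Local Notation E := 'rV[R]_N.
Local Notation mu := (lebesgue_rV R N).
Implicit Types (s p : R) (Omega : set E) (u v xi : E -> R).

(* the library norm on row vectors is the sup norm *)
Definition eucl (x : E) : R := Num.sqrt (\sum_(i < N) x 0 i ^+ 2).

Definition gagliardo s p u : \bar R :=
  ((\int[(mu \x mu)%E]_z
     (`|u z.1 - u z.2| `^ p / eucl (z.1 - z.2) `^ (N%:R + p * s))%:E)
   `^ p^-1)%E.

Definition sobolev_norm s p u : \bar R :=
  ('N[mu]_(p%:E)[EFin \o u] + gagliardo s p u)%E.

Definition sobolev s p : set (E -> R) :=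
  [set u | u \in Lfun mu p%:E /\ (gagliardo s p u < +oo)%E].

Fixpoint Ck (k : nat) (f : E -> R) : Prop :=
  continuous f /\
  if k is k'.+1 then
    forall i : 'I_N, (forall x, derivable f x (delta_mx 0 i)) /\
                     Ck k' (fun x => 'D_(delta_mx 0 i) f x)
  else True.

Definition Cc_infty Omega : set (E -> R) :=
  [set phi | (forall k, Ck k phi) /\
             compact (closure [set x | phi x != 0]) /\
             closure [set x | phi x != 0] `<=` Omega].

(* Since W^{s,p}(R^N) is complete, the completion of C_0^oo(Omega) is its
   closure in W^{s,p}(R^N). Elements of L^p are represented by functions, and
   equality in L^p is equality almost everywhere. *)
Definition sobolev0 s p Omega : set (E -> R) :=
  [set u | sobolev s p u /\ forall e : R, 0 < e ->
    exists2 phi, Cc_infty Omega phi & (sobolev_norm s p (u \- phi)%R < e%:E)%E].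

(* <D[u]_p^p, xi>; powR satisfies 0 `^ a = (a == 0)%:R, so that
   |t|^(p-2) t vanishes at t = 0 *)
Definition dgagliardo s p u xi : \bar R :=
  (p%:E * \int[(mu \x mu)%E]_z
     (`|u z.1 - u z.2| `^ (p - 2) * (u z.1 - u z.2) * (xi z.1 - xi z.2)
      / eucl (z.1 - z.2) `^ (N%:R + p * s))%:E)%E.

Definition pospart u : E -> R := fun x => Num.max (u x) 0.
Definition negpart u : E -> R := fun x => Num.min (u x) 0.

Definition sphere s p Omega : set (E -> R) :=
  [set u | sobolev0 s p Omega u /\ ('N[mu]_(p%:E)[EFin \o u] = 1)%E].

Definition S1 : set (R * R) := [set t | t.1 ^+ 2 + t.2 ^+ 2 = 1].

(* h is a continuous odd surjection from S^1 onto A, A being read modulo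
   equality almost everywhere; the values of h outside S^1 are irrelevant *)
Definition continuous_odd_surjection s p (A : set (E -> R))
    (h : R * R -> E -> R) : Prop :=
  [/\ forall t, S1 t -> A (h t),
      forall u, A u -> exists2 t, S1 t & h t = u %[ae mu],
      forall t, S1 t -> h (- t) = (\- h t)%R %[ae mu] &
      forall t, S1 t ->
        sobolev_norm s p (h t' \- h t)%R @[t' --> within S1 (nbhs t)] --> 0%E].

Definition G2 s p Omega : set (set (E -> R)) :=
  [set A | A `<=` sphere s p Omega /\
           exists h, continuous_odd_surjection s p A h].

Definition lambda2 s p Omega : \bar R :=
  ereal_inf [set ereal_sup [set (gagliardo s p u `^ p)%E | u in A]
            | A in G2 s p Omega].

Definition second_eigenfunction s p Omega u : Prop :=
  [/\ sobolev0 s p Omega u,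
      ~ (u = cst 0 %[ae mu]) &
      forall xi, sobolev0 s p Omega xi ->
        ((p^-1)%:E * dgagliardo s p u xi =
         lambda2 s p Omega *
           \int[mu]_(x in Omega) (`|u x| `^ (p - 2) * u x * xi x)%:E)%E].

End fractional_sobolev.

(* Main.v *)
Require Import Defs.
From mathcomp Require Import all_boot all_order all_algebra.
From mathcomp Require Import all_classical all_reals all_analysis.
From mathcomp Require Import ring lra measurable_realfun.

Import Order.TTheory GRing.Theory Num.Theory.
Import numFieldNormedType.Exports.

Local Open Scope classical_set_scope.
Local Open Scope ring_scope.

(** Write v = v+ + v-, and consider the circle of functions al v+ + be v-. The
differences v+(x) - v+(y) and v-(x) - v-(y) have the same sign, so Jensen's
inequality for |t|^p, with these differences as weights, gives
[al v+ + be v-]^p <= |al|^p <D[v],v+> / p + |be|^p <D[v],v-> / p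
(pint_quo_comb_le). Since v+ and v- have disjoint supports, the two hypotheses
turn this into [u]^p <= lambda2 ||u||^p for every u on the circle, with a strict
inequality when al <> be, because the two truncations interact on
{v > 0} x {v < 0} (pint_quo_comb_lt). So the circle, once normalized, is optimal
in the definition of lambda2, and only its points proportional to v can reach
the level lambda2.

Normalizing the unit circle of a plane contained in W_0^{s,p} gives an element
of G_2, so such a circle cannot lie strictly below the level lambda2: by
compactness its maximum would be smaller than lambda2 (lambda2_lt). If one of
the two hypotheses were strict, the circle above would lie strictly below that
level; hence both are equalities (energy_eq). If v did not solve the
eigenvalue equation, some direction xi would decrease
[.]^p - lambda2 ||.||^p at v to first order. Replacing v+ and v- by
v+ + e xi / 2 and v- + e xi / 2 for a small e > 0 moves v to v + e xi, and
again pushes the whole circle strictly below the level (deform_circle_lt). This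
step relies only on the convexity and the continuity of p-th powers of norms
on finite-dimensional spaces and on their directional derivatives at v.

Two facts about function spaces support the argument. Both terms of the
Sobolev norm are L^p norms, of u and of the quotient
(u(x) - u(y)) / |x - y|^((N + p s) / p), so the estimates are proved for L^p
over an arbitrary measure space. The truncations v+ and v- stay in the
closure of the test functions (sobolev0_pospart): if phi_n is close to v, then
a smooth approximation of max(t, 0) applied to phi_n is a test function, and
dominated convergence shows that it is close to v+. *)

(** * Scalar inequalities for the convex function |t|^p *)

(** The derivative of |t|^p / p. *)
Definition dpow {R : realType} (p t : R) : R := `|t| `^ (p - 2) * t.

Section scalar.
Context (R : realType) (p : R).
Hypothesis p1 : 1 < p.
Implicit Types a b t x y : R.

Let p0 : 0 < p. Proof. exact: lt_trans p1. Qed.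

(** After division by y this is the sum of the inequalities 1 + x < exp x at
x = - ln y, with weight p - 1, and at x = (p - 1) ln y. *)
Lemma bernoulli_powR_lt y : 0 <= y -> y != 1 -> p * y < p - 1 + y `^ p.
Proof.
rewrite le_eqVlt => /predU1P[<- _|y0 y1].
  by rewrite mulr0 powR0 ?gt_eqF// addr0 subr_gt0.
have lny0 : ln y != 0.
  by apply: contra y1 => /eqP lny; rewrite -(lnK (x := y)) ?posrE// lny expR0.
have h1 : 1 + - ln y < expR (- ln y) by rewrite expR_gt1Dx// oppr_eq0.
have h2 : 1 + (p - 1) * ln y < expR ((p - 1) * ln y).
  by rewrite expR_gt1Dx// mulf_neq0// gt_eqF// subr_gt0.
have -> : y `^ p = y * expR ((p - 1) * ln y).
  by rewrite -(mulr_powRB1 (ltW y0) p0) /powR gt_eqF.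
have yV : y * expR (- ln y) = 1.
  by rewrite -{1}(lnK (x := y)) ?posrE// -expRD subrr expR0.
have p10 : 0 < p - 1 by rewrite subr_gt0.
have : y * ((p - 1) * (1 + - ln y) + (1 + (p - 1) * ln y)) <
       y * ((p - 1) * expR (- ln y) + expR ((p - 1) * ln y)).
  by rewrite ltr_pM2l// ltrD// ltr_pM2l.
rewrite [X in _ < X]mulrDr [in X in _ < X]mulrCA yV mulr1.
by apply: le_lt_trans; rewrite le_eqVlt; apply/orP; left; apply/eqP; ring.
Qed.

Lemma norm_dpow t : `|dpow p t| = `|t| `^ (p - 1).
Proof.
rewrite /dpow normrM (ger0_norm (powR_ge0 _ _)) mulrC.
have [->|t0] := eqVneq t 0.
  by rewrite normr0 mul0r powR0// subr_eq0 gt_eqF.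
rewrite (_ : p - 1 = 1 + (p - 2)); last by ring.
rewrite [RHS]powRD; last by rewrite normr_eq0 t0 implybT.
by rewrite powRr1.
Qed.

Lemma dpowM t : dpow p t * t = `|t| `^ p.
Proof.
rewrite -(mulr_powRB1 (normr_ge0 t) p0) -norm_dpow /dpow normrM.
rewrite (ger0_norm (powR_ge0 _ _)) mulrCA -normrM -mulrA; congr (_ * _).
by rewrite ger0_norm// -expr2 sqr_ge0.
Qed.

Lemma young_powR_lt a b : 0 <= a -> 0 <= b -> a != b ->
  p * (a `^ (p - 1) * b) < (p - 1) * a `^ p + b `^ p.
Proof.
rewrite le_eqVlt => /predU1P[<-|a0 b0 ab].
  move=> b0; rewrite eq_sym => bn0.
  rewrite powR0 ?subr_eq0 ?gt_eqF// mul0r mulr0 powR0 ?gt_eqF// mulr0 add0r.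
  by rewrite powR_gt0// lt0r bn0.
have ba0 : 0 <= b / a by rewrite divr_ge0// ltW.
have : b / a != 1.
  by apply: contra ab => /eqP h; rewrite -(divfK (lt0r_neq0 a0) b) h mul1r.
move=> /(bernoulli_powR_lt _ ba0); rewrite -(ltr_pM2l (powR_gt0 p a0)).
have aba : a * (b / a) = b by rewrite mulrC divfK// gt_eqF.
rewrite [X in _ < X]mulrDr -powRM//; last exact: ltW.
rewrite aba [X in _ < X + _]mulrC; apply: le_lt_trans.
rewrite le_eqVlt; apply/orP; left; apply/eqP.
rewrite -(mulr_powRB1 (ltW a0) p0).
by field; exact: lt0r_neq0.
Qed.

Lemma young_powR a b : 0 <= a -> 0 <= b ->
  p * (a `^ (p - 1) * b) <= (p - 1) * a `^ p + b `^ p.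
Proof.
move=> a0 b0; have [<-|ab] := eqVneq a b; last exact/ltW/young_powR_lt.
by rewrite mulrC [_ * a]mulrC mulr_powRB1// mulrBl mul1r subrK mulrC.
Qed.

(** The graph of |t|^p lies above its tangents, strictly away from the
contact point: for |x| <> |y| this is Young's inequality, and for y = - x
the tangent at x takes the value (1 - 2 p) |x|^p. *)
Lemma dpow_tangent_lt x y : x != y ->
  `|x| `^ p + p * dpow p x * (y - x) < `|y| `^ p.
Proof.
move=> xy; rewrite mulrBr -[X in _ - X]mulrA dpowM.
suff : p * (dpow p x * y) < (p - 1) * `|x| `^ p + `|y| `^ p.
  by rewrite -[p * _ * y]mulrA; move: (dpow p x * y) => z; lra.
have [nxy|nxy] := eqVneq `|x| `|y|; last first.
  apply: le_lt_trans (young_powR_lt _ _ (normr_ge0 x) (normr_ge0 y) nxy).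
  by rewrite ler_pM2l// -norm_dpow -normrM ler_norm.
have yN : y = - x.
  by have /eqP := nxy; rewrite eqr_norm2 (negbTE xy)/= => /eqP ->; rewrite opprK.
have x0 : x != 0 by apply: contra xy; rewrite yN => /eqP ->; rewrite oppr0.
rewrite -nxy yN mulrN dpowM.
have : 0 < `|x| `^ p by rewrite powR_gt0// normr_gt0.
by have := p0; move: (`|x| `^ p) => z; nra.
Qed.

Lemma dpow_tangent x y : `|x| `^ p + p * dpow p x * (y - x) <= `|y| `^ p.
Proof.
have [<-|xy] := eqVneq x y; last exact/ltW/dpow_tangent_lt.
by rewrite subrr mulr0 addr0.
Qed.

Lemma convex_norm_powR x y t : 0 <= t <= 1 ->
  `|(1 - t) * x + t * y| `^ p <= (1 - t) * `|x| `^ p + t * `|y| `^ p.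
Proof.
move=> /andP[t0 t1]; set m := (1 - t) * x + t * y.
have hx := dpow_tangent m x; have hy := dpow_tangent m y.
have t1' : 0 <= 1 - t by rewrite subr_ge0.
have := lerD (ler_wpM2l t1' hx) (ler_wpM2l t0 hy).
apply: le_trans; rewrite le_eqVlt; apply/orP; left; apply/eqP.
by rewrite /m; ring.
Qed.

Let jensen_aux a b (al be : R) : a + b != 0 ->
  (al * a + be * b) / (a + b) = be + a / (a + b) * (al - be) /\
  dpow p (a + b) * (`|al| `^ p * a + `|be| `^ p * b) -
  `|al * a + be * b| `^ p =
  `|a + b| `^ p * (a / (a + b) * (`|al| `^ p) + b / (a + b) * (`|be| `^ p)
                   - `|(al * a + be * b) / (a + b)| `^ p).
Proof.
move=> ab0; split; first by field.
have E : (al * a + be * b) = (a + b) * ((al * a + be * b) / (a + b)) by field.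
rewrite mulrBr [in LHS]E normrM powRM//; congr (_ - _).
by rewrite -(dpowM (a + b)); field.
Qed.

(** Jensen's inequality for |t|^p at the points al and be, with the weights
a / (a + b) and b / (a + b); these are nonnegative because a and b have the
same sign. *)
Lemma jensen_dpow a b (al be : R) : 0 <= a * b ->
  `|al * a + be * b| `^ p <= dpow p (a + b) * (`|al| `^ p * a + `|be| `^ p * b).
Proof.
move=> ab; have [ab0|ab0] := eqVneq (a + b) 0.
  have a0 : a = 0 by nra.
  have b0 : b = 0 by nra.
  by rewrite a0 b0 !mulr0 !addr0 mulr0 normr0 powR0// gt_eqF.
rewrite -subr_ge0; have [_ ->] := jensen_aux a b al be ab0.
rewrite mulr_ge0 ?powR_ge0// subr_ge0; set m := _ / _ : R.
have wa : 0 <= a / (a + b).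
  rewrite (_ : _ / _ = (a * (a + b)) / (a + b) ^+ 2); last by field.
  by rewrite divr_ge0// ?sqr_ge0//; nra.
have wb : 0 <= b / (a + b).
  rewrite (_ : _ / _ = (b * (a + b)) / (a + b) ^+ 2); last by field.
  by rewrite divr_ge0// ?sqr_ge0//; nra.
have := lerD (ler_wpM2l wa (dpow_tangent m al)) (ler_wpM2l wb (dpow_tangent m be)).
apply: le_trans; rewrite le_eqVlt; apply/orP; left; apply/eqP.
by rewrite /m; field.
Qed.

Lemma jensen_dpow_lt a b (al be : R) : 0 < a * b -> al != be ->
  `|al * a + be * b| `^ p < dpow p (a + b) * (`|al| `^ p * a + `|be| `^ p * b).
Proof.
move=> ab albe; have ab0 : a + b != 0 by apply/eqP; nra.
rewrite -subr_gt0; have [mE ->] := jensen_aux a b al be ab0.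
rewrite mulr_gt0 ?powR_gt0// ?normr_gt0// subr_gt0; set m := _ / _ : R in mE *.
have wa : 0 < a / (a + b).
  rewrite (_ : _ / _ = (a * (a + b)) / (a + b) ^+ 2); last by field.
  by rewrite divr_gt0// ?exprn_even_gt0//=; nra.
have wb : 0 < b / (a + b).
  rewrite (_ : _ / _ = (b * (a + b)) / (a + b) ^+ 2); last by field.
  by rewrite divr_gt0// ?exprn_even_gt0//=; nra.
have mbe : m != be.
  by rewrite -subr_eq0 mE [be + _]addrC addrK mulf_neq0 ?subr_eq0// gt_eqF.
have := ler_ltD (ler_wpM2l (ltW wa) (dpow_tangent m al)).
move=> /(_ (b / (a + b) * (`|m| `^ p + p * dpow p m * (be - m))) (b / (a + b) * (`|be| `^ p))).
rewrite ltr_pM2l// dpow_tangent_lt// => /(_ isT).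
apply: le_lt_trans; rewrite le_eqVlt; apply/orP; left; apply/eqP.
by rewrite /m; field.
Qed.

Lemma measurable_dpow : measurable_fun setT (dpow p).
Proof.
apply: measurable_funM => //.
by apply: (measurableT_comp (measurable_powR _)) => //; exact: measurableT_comp.
Qed.

Lemma continuous_norm_powR_neq0 (r x : R) : x != 0 ->
  {for x, continuous (fun t : R => `|t| `^ r)}.
Proof.
move=> x0; have h : {for `|x|, continuous (fun t : R => t `^ r)}.
  apply: differentiable_continuous; apply/derivable1_diffP.
  by apply: derivable_powR; rewrite in_itv/= andbT normr_gt0.
exact: (cvg_comp _ _ (@norm_continuous _ _ x) h).
Qed.

Lemma continuous_norm_powR (r : R) : 0 < r -> continuous (fun t : R => `|t| `^ r).
Proof.
move=> r0 x; have [->|x0] := eqVneq x 0.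
  rewrite /continuous_at normr0 powR0 ?gt_eqF//; apply/cvgr0Pnorm_lt => e e0.
  have er : 0 < e `^ r^-1 by exact: powR_gt0.
  near=> t.
  have te : `|t| < e `^ r^-1 by near: t; exists (e `^ r^-1) => //= t; rewrite /= sub0r normrN.
  have ee : e = (e `^ r^-1) `^ r by rewrite -powRrM mulVf ?gt_eqF// powRr1// ltW.
  rewrite ger0_norm ?powR_ge0// [ltRHS]ee.
  by rewrite gt0_ltr_powR ?nnegrE ?normr_ge0 ?powR_ge0.
exact: continuous_norm_powR_neq0.
Unshelve. all: end_near. Qed.

Lemma norm_powR_cvg0 {J : Type} (F : set_system J) {FF : Filter F} (r : R) (u : J -> R) :
  0 < r -> u @ F --> (0 : R) -> `|u i| `^ r @[i --> F] --> (0 : R).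
Proof.
move=> r0 u0; have := cvg_comp _ _ u0 (continuous_norm_powR r r0 0).
by rewrite /= normr0 powR0// gt_eqF.
Qed.

Lemma continuous_dpow : continuous (dpow p).
Proof.
move=> x; have [->|x0] := eqVneq x 0.
  have p10 : 0 < p - 1 by rewrite subr_gt0.
  have d0 : dpow p 0 = 0 by rewrite /dpow mulr0.
  have := continuous_norm_powR (p - 1) p10 0.
  rewrite /continuous_at normr0 powR0 ?gt_eqF// d0.
  under [X in X @ _ --> _ -> _]eq_fun do rewrite -norm_dpow.
  by move/norm_cvg0P.
apply: cvgM; last exact: cvg_id.
exact: (continuous_norm_powR_neq0 (p - 2) x x0).
Qed.

End scalar.

Arguments bernoulli_powR_lt {R p}.
Arguments norm_dpow {R p}.
Arguments dpowM {R p}.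
Arguments young_powR_lt {R p}.
Arguments young_powR {R p}.
Arguments dpow_tangent_lt {R p}.
Arguments dpow_tangent {R p}.
Arguments convex_norm_powR {R p}.
Arguments jensen_dpow {R p}.
Arguments jensen_dpow_lt {R p}.
Arguments measurable_dpow {R p}.
Arguments continuous_norm_powR {R}.
Arguments continuous_dpow {R p}.
Arguments norm_powR_cvg0 {R J F FF r u}.

(** * The p-th power of the norm of L^p *)

Definition pint {d} {T : measurableType d} {R : realType}
  (mu : {measure set T -> \bar R}) (p : R) (f : T -> R) : R :=
  (\int[mu]_x (`|f x| `^ p))%R.

Definition pnorm {d} {T : measurableType d} {R : realType}
  (mu : {measure set T -> \bar R}) (p : R) (f : T -> R) : R :=
  fine ('N[mu]_(p%:E)[EFin \o f])%E.

Section Lp.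
Context (d : measure_display) (T : measurableType d) (R : realType).
Variables (mu : {measure set T -> \bar R}) (p : R).
Hypothesis p1 : 1 < p.
Implicit Types f g h : T -> R.
Local Notation L := (Lfun mu p%:E).
Local Notation I := (pint mu p).
Local Notation N := (pnorm mu p).

Let p0 : 0 < p. Proof. exact: lt_trans p1. Qed.
Let pn0 : p != 0. Proof. by rewrite gt_eqF. Qed.
Let lep1 : (1%:E <= p%:E)%E. Proof. by rewrite lee_fin ltW. Qed.

Lemma LnormE f : ('N[mu]_(p%:E)[EFin \o f] =
  (\int[mu]_x (`|f x| `^ p)%:E) `^ p^-1)%E.
Proof. by rewrite unlock. Qed.

Lemma measurable_norm_powR f : measurable_fun setT f ->
  measurable_fun setT (fun x => `|f x| `^ p).
Proof.
move=> mf; apply: (measurableT_comp (measurable_powR _)) => //.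
exact: measurableT_comp.
Qed.

Lemma Lfun_measurable f : f \in L -> measurable_fun setT f.
Proof. by rewrite inE => /andP[/[!inE]]. Qed.

Lemma Lfun_Lnorm f : f \in L -> ('N[mu]_(p%:E)[EFin \o f] < +oo)%E.
Proof. by rewrite inE => /andP[_ /[!inE]]. Qed.

Lemma LfunI f : measurable_fun setT f ->
  (\int[mu]_x (`|f x| `^ p)%:E < +oo)%E -> f \in L.
Proof.
move=> mf fi; rewrite inE; apply/andP; split; rewrite inE//=.
by rewrite /finite_norm LnormE poweR_lty.
Qed.

Lemma Lfun_Lnorm_fin f : f \in L -> ('N[mu]_(p%:E)[EFin \o f] \is a fin_num)%E.
Proof. by move=> /Lfun_Lnorm; rewrite ge0_fin_numE// Lnorm_ge0. Qed.

Lemma pnormE f : f \in L -> ((N f)%:E = 'N[mu]_(p%:E)[EFin \o f])%E.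
Proof. by move=> /Lfun_Lnorm_fin ?; rewrite fineK. Qed.

Lemma pnorm_ge0 f : 0 <= N f.
Proof. by rewrite fine_ge0// Lnorm_ge0. Qed.

Lemma Lfun_pintegrable f : f \in L -> mu.-integrable setT (fun x => (`|f x| `^ p)%:E).
Proof. by move=> /(Lfun_integrable (ltW p1)). Qed.

Lemma pint_ge0 f : 0 <= I f.
Proof. by apply: Rintegral_ge0 => x _; exact: powR_ge0. Qed.

Lemma pintE f : f \in L -> ((I f)%:E = \int[mu]_x (`|f x| `^ p)%:E)%E.
Proof.
move=> /Lfun_pintegrable fi; rewrite /pint /Rintegral fineK//.
exact: integrable_fin_num.
Qed.

Lemma pint_pnorm f : I f = N f `^ p.
Proof.
rewrite /pnorm LnormE fine_poweR -powRrM mulVf// powRr1//.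
by rewrite fine_ge0//; apply: integral_ge0 => x _; rewrite lee_fin powR_ge0.
Qed.

Lemma LfunD f g : f \in L -> g \in L -> (fun x => f x + g x) \in L.
Proof. by move=> fL gL; have [_ /(_ f g fL gL)] := Lfun_addr_closed mu lep1. Qed.

Lemma LfunZ (a : R) f : f \in L -> (fun x => a * f x) \in L.
Proof.
by move=> fL; have := Lfun_submod_closed mu lep1; move=> [] L0 /(_ a f _ fL L0); rewrite addr0.
Qed.

Lemma LfunB f g : f \in L -> g \in L -> (fun x => f x - g x) \in L.
Proof.
move=> fL gL; have := LfunD f _ fL (LfunZ (-1) g gL).
by under eq_fun do rewrite mulN1r.
Qed.

Lemma Lfun_le f g : measurable_fun setT f -> (forall x, `|f x| <= `|g x|) ->
  g \in L -> f \in L.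
Proof.
move=> mf fg gL; apply: LfunI => //.
have := Lfun_pintegrable g gL => /integrableP[mg]; apply: le_lt_trans.
apply: ge0_le_integral => //.
- exact/measurable_EFinP/measurable_norm_powR.
- exact: measurableT_comp.
- move=> x _; rewrite gee0_abs ?lee_fin ?powR_ge0//.
  by rewrite ge0_ler_powR ?nnegrE ?(ltW p0).
Qed.

Lemma pnormD f g : f \in L -> g \in L -> N (fun x => f x + g x) <= N f + N g.
Proof.
move=> fL gL; rewrite -lee_fin EFinD !pnormE//; last exact: LfunD.
by apply: minkowski_EFin; [exact: Lfun_measurable|exact: Lfun_measurable|exact: ltW].
Qed.

Lemma pintZ (a : R) f : f \in L -> I (fun x => a * f x) = `|a| `^ p * I f.
Proof.
move=> fL; rewrite /pint -RintegralZl//; last exact: Lfun_pintegrable.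
by apply: eq_Rintegral => x _; rewrite normrM powRM.
Qed.

Lemma pnorm_powR f : N f = I f `^ p^-1.
Proof. by rewrite pint_pnorm -powRrM mulfV// powRr1// pnorm_ge0. Qed.

Lemma pnormZ (a : R) f : f \in L -> N (fun x => a * f x) = `|a| * N f.
Proof.
move=> fL; rewrite pnorm_powR pintZ// powRM ?powR_ge0 ?pint_ge0//.
by rewrite -pnorm_powR -powRrM mulfV// powRr1.
Qed.

Lemma pnormBC f g : N (fun x => f x - g x) = N (fun x => g x - f x).
Proof.
have E : (fun x => `|f x - g x| `^ p) = (fun x => `|g x - f x| `^ p).
  by apply/funext => x; rewrite distrC.
by rewrite !pnorm_powR /pint E.
Qed.

Lemma pnorm_le f g : measurable_fun setT f -> (forall x, `|f x| <= `|g x|) ->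
  g \in L -> N f <= N g.
Proof.
move=> mf fg gL; have fL := Lfun_le f g mf fg gL.
rewrite !pnorm_powR ge0_ler_powR ?invr_ge0 ?nnegrE ?pint_ge0 ?(ltW p0)//.
apply: le_Rintegral => //; [exact: Lfun_pintegrable|exact: Lfun_pintegrable|].
by move=> x _; rewrite ge0_ler_powR ?nnegrE ?(ltW p0).
Qed.

Lemma pnorm_dist f g : f \in L -> g \in L -> `|N f - N g| <= N (fun x => f x - g x).
Proof.
move=> fL gL; have h a b : a \in L -> b \in L -> N a - N b <= N (fun x => a x - b x).
  move=> aL bL; rewrite lerBlDr; apply: le_trans (pnormD _ _ _ _) => //; last exact: LfunB.
  by rewrite (_ : (fun x => _) = a)//; apply/funext => x; rewrite subrK.
rewrite ler_norml h// andbT lerNl opprB pnormBC; exact: h.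
Qed.

(** Three generators suffice: two span the plane of the circle, the third is
the direction of its deformation. *)
Definition lin3 f g h (a b c : R) : T -> R := fun x => a * f x + b * g x + c * h x.

Lemma Lfun_lin3 f g h a b c : f \in L -> g \in L -> h \in L -> lin3 f g h a b c \in L.
Proof. by move=> *; apply: LfunD; [apply: LfunD|]; exact: LfunZ. Qed.

Lemma pnorm_lin3_cvg {J : Type} (F : set_system J) {FF : Filter F}
    (a_ b_ c_ : J -> R) (a b c : R) f g h :
  f \in L -> g \in L -> h \in L ->
  a_ @ F --> a -> b_ @ F --> b -> c_ @ F --> c ->
  N (lin3 f g h (a_ i) (b_ i) (c_ i)) @[i --> F] --> N (lin3 f g h a b c).
Proof.
move=> fL gL hL Fa Fb Fc.
have H i : `|N (lin3 f g h a b c) - N (lin3 f g h (a_ i) (b_ i) (c_ i))|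
    <= `|a_ i - a| * N f + `|b_ i - b| * N g + `|c_ i - c| * N h.
  rewrite distrC; apply: le_trans (pnorm_dist _ _ _ _) _; [exact: Lfun_lin3..|].
  rewrite -!pnormZ//.
  rewrite (_ : (fun x => _) = (fun x => (a_ i - a) * f x + (b_ i - b) * g x + (c_ i - c) * h x)).
    apply: le_trans (pnormD _ _ _ _) _; [by apply: LfunD; exact: LfunZ|exact: LfunZ|].
    by rewrite lerD2r; apply: pnormD; exact: LfunZ.
  by apply/funext => x; rewrite /lin3; ring.
have B0 : `|a_ i - a| * N f + `|b_ i - b| * N g + `|c_ i - c| * N h @[i --> F] --> (0 : R).
  have z : (0 : R) = 0 * N f + 0 * N g + 0 * N h by ring.
  have nd (k : R) (k_ : J -> R) : k_ @ F --> k -> `|k_ i - k| @[i --> F] --> (0 : R).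
    move=> kk; rewrite -(normr0 R) -(subrr k).
    by apply: cvg_norm; apply: cvgB => //; exact: cvg_cst.
  by rewrite z; apply: cvgD; [apply: cvgD|];
    (apply: cvgM; [exact: nd|exact: cvg_cst]).
apply/cvgrPdist_lt => e e0; move/cvgr0Pnorm_lt : B0 => /(_ _ e0).
by apply: filterS => i; apply: le_lt_trans; apply: le_trans (ler_norm _).
Qed.

Lemma pint_lin3_cvg {J : Type} (F : set_system J) {FF : Filter F}
    (a_ b_ c_ : J -> R) (a b c : R) f g h :
  f \in L -> g \in L -> h \in L ->
  a_ @ F --> a -> b_ @ F --> b -> c_ @ F --> c ->
  I (lin3 f g h (a_ i) (b_ i) (c_ i)) @[i --> F] --> I (lin3 f g h a b c).
Proof.
move=> fL gL hL Fa Fb Fc.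
have h1 := pnorm_lin3_cvg F a_ b_ c_ a b c f g h fL gL hL Fa Fb Fc.
rewrite pint_pnorm -(ger0_norm (pnorm_ge0 _)).
under eq_fun do rewrite pint_pnorm -[X in X `^ _](ger0_norm (pnorm_ge0 _)).
exact: (cvg_comp _ _ (h1 FF) (continuous_norm_powR p p0 _)).
Qed.

(** Young's inequality bounds the product by |f|^p and |g|^p. *)
Lemma integrable_dpow f g : f \in L -> g \in L ->
  mu.-integrable setT (EFin \o (fun x => dpow p (f x) * g x)).
Proof.
move=> fL gL; have fi := Lfun_pintegrable f fL; have gi := Lfun_pintegrable g gL.
apply: (le_integrable _ _ _ (integrableD measurableT (integrableZl measurableT (p - 1) fi) gi)) => //.
  apply/measurable_EFinP; apply: measurable_funM; last exact: Lfun_measurable.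
  by apply: measurableT_comp; [exact: measurable_dpow|exact: Lfun_measurable].
move=> x _ /=; rewrite lee_fin [leRHS]ger0_norm; last first.
  by rewrite addr_ge0 ?mulr_ge0 ?powR_ge0// subr_ge0 ltW.
apply: le_trans (young_powR p1 _ _ (normr_ge0 (f x)) (normr_ge0 (g x))).
rewrite normrM norm_dpow// ler_peMl ?mulr_ge0 ?powR_ge0//; exact: ltW.
Qed.

(** Convexity bounds a small step e by a fixed step eta, whatever the base
point f; this replaces the continuity of the derivative near f. *)
Lemma pint_convex f g (e eta : R) : f \in L -> g \in L -> 0 <= e <= eta -> 0 < eta ->
  I (fun x => f x + e * g x) <= I f + e / eta * (I (fun x => f x + eta * g x) - I f).
Proof.
move=> fL gL /andP[e0 eeta] eta0.
have feL : (fun x => f x + e * g x) \in L by apply: LfunD => //; exact: LfunZ.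
have fetaL : (fun x => f x + eta * g x) \in L by apply: LfunD => //; exact: LfunZ.
set t := e / eta.
have t0 : 0 <= t by rewrite divr_ge0// ltW.
have t1 : t <= 1 by rewrite ler_pdivrMr// mul1r.
have fi := Lfun_pintegrable f fL; have fei := Lfun_pintegrable _ fetaL.
have tE (a b : R) : a + t * (b - a) = (1 - t) * a + t * b by ring.
rewrite tE.
rewrite /pint -!RintegralZl// -RintegralD//; last 2 first.
  by rewrite /=; apply: (integrableZl measurableT _ fi).
  by rewrite /=; apply: (integrableZl measurableT _ fei).
apply: le_Rintegral => //; first exact: Lfun_pintegrable.
  by apply: (integrableD measurableT (integrableZl measurableT _ fi) (integrableZl measurableT _ fei)).
move=> x _; apply: le_trans (convex_norm_powR p1 _ _ t _); last by rewrite t0.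
rewrite (_ : f x + e * g x = (1 - t) * f x + t * (f x + eta * g x))//.
by rewrite /t; field; rewrite gt_eqF.
Qed.

(** The directional derivative of the p-th power of the norm. The difference
quotients are squeezed between the tangents at f and at the moved point, and
for steps at most 1 they are dominated through convexity. *)
Lemma pint_derivative f g : f \in L -> g \in L ->
  n.+1%:R * (I (fun x => f x + n.+1%:R^-1 * g x) - I f) @[n --> \oo]
  --> (p * \int[mu]_x (dpow p (f x) * g x))%R.
Proof.
move=> fL gL.
pose q n x : R := n.+1%:R * (`|f x + n.+1%:R^-1 * g x| `^ p - `|f x| `^ p).
have n0 n : 0 < n.+1%:R :> R by [].
have fnL n : (fun x => f x + n.+1%:R^-1 * g x) \in L by apply: LfunD => //; exact: LfunZ.
have fi := Lfun_pintegrable f fL.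
have qi n : mu.-integrable setT (EFin \o q n).
  exact: (integrableZl measurableT (n.+1%:R : R)
    (integrableB measurableT (Lfun_pintegrable _ (fnL n)) fi)).
have qE n : n.+1%:R * (I (fun x => f x + n.+1%:R^-1 * g x) - I f) =
    (\int[mu]_x q n x)%R.
  rewrite /pint -RintegralB//; last exact: (Lfun_pintegrable _ (fnL n)).
  rewrite -RintegralZl//.
  exact: (integrableB measurableT (Lfun_pintegrable _ (fnL n)) fi).
have dfg := integrable_dpow f g fL gL.
have pdfg : mu.-integrable setT (EFin \o (fun x => p * (dpow p (f x) * g x))).
  exact: (integrableZl measurableT p dfg).
rewrite -RintegralZl//; under eq_fun do rewrite qE.
(* the tangent at f x, evaluated at the moved point *)
have lo n x : p * (dpow p (f x) * g x) <= q n x.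
  have := dpow_tangent p1 (f x) (f x + n.+1%:R^-1 * g x).
  rewrite [f x + _]addrC addrK -lerBrDl -(ler_pM2l (n0 n)) => h.
  rewrite /q [f x + _]addrC; apply: le_trans _ h.
  by rewrite le_eqVlt; apply/orP; left; apply/eqP; field.
(* the tangent at the moved point, evaluated at f x *)
have hi n x : q n x <= p * (dpow p (f x + n.+1%:R^-1 * g x) * g x).
  have := dpow_tangent p1 (f x + n.+1%:R^-1 * g x) (f x).
  rewrite opprD addNKr -lerBrDl -(ler_pM2l (n0 n)) => h.
  rewrite /q -[`|_ + _| `^ p - _]opprB mulrN lerNl; apply: le_trans _ h.
  by rewrite le_eqVlt; apply/orP; left; apply/eqP; field.
(* a bound that does not depend on n *)
have ub n x : q n x <= `|f x + g x| `^ p.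
  have n01 : 0 <= (n.+1%:R^-1 : R) <= 1.
    by rewrite invr_ge0 ler0n/= invf_le1// ler1n.
  have := convex_norm_powR p1 (f x) (f x + g x) _ n01.
  rewrite (_ : (1 - _) * _ + _ = f x + n.+1%:R^-1 * g x); last by ring.
  rewrite -lerBlDl -(ler_pM2l (n0 n)) => h.
  rewrite mulrA mulfV ?lt0r_neq0// mul1r in h; apply: le_trans h.
  rewrite (_ : n.+1%:R * _ = q n x + `|f x| `^ p) ?lerDl ?powR_ge0//.
  by rewrite /q; field.
have qcvg x : q n x @[n --> \oo] --> p * (dpow p (f x) * g x).
  apply: (@squeeze_cvgr _ _ _ _ (fun=> p * (dpow p (f x) * g x))
     (fun n => p * (dpow p (f x + n.+1%:R^-1 * g x) * g x))).
  - by apply: nearW => n; rewrite lo hi.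
  - exact: cvg_cst.
  - apply: cvgM; first exact: cvg_cst.
    apply: cvgM; last exact: cvg_cst.
    have fx : f x + n.+1%:R^-1 * g x @[n --> \oo] --> f x.
      rewrite -[X in _ --> X](addr0 (f x)) -(mul0r (g x)).
      apply: cvgD; first exact: cvg_cst.
      by apply: cvgM; [exact: cvg_harmonic|exact: cvg_cst].
    exact: (cvg_comp _ _ fx (continuous_dpow p1 _)).
have gi : mu.-integrable setT
    (fun x => `|(p * (dpow p (f x) * g x))%:E| + (`|f x + g x| `^ p)%:E)%E.
  apply: integrableD => //; first exact: integrable_abse pdfg.
  exact: (Lfun_pintegrable _ (LfunD _ _ fL gL)).
have : (\int[mu]_x (q n x)%:E)%E @[n --> \oo] --> (\int[mu]_x (p * (dpow p (f x) * g x))%:E)%E.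
  apply: (dominated_cvg measurableT _ _ _ gi) => //.
  - by move=> n; exact: (measurable_int _ (qi n)).
  - by move=> x _; apply: cvg_EFin; [exact: nearW|exact: qcvg].
  - move=> n x _; rewrite /= -EFinD lee_fin ler_norml; apply/andP; split.
      apply: le_trans (lo n x); rewrite lerNl.
      rewrite (le_trans (ler_norm _))// normrN lerDl powR_ge0//.
    by apply: le_trans (ub n x) _; rewrite lerDr.
move=> h; apply: fine_cvg; rewrite /Rintegral fineK//.
exact: integrable_fin_num.
Qed.

(** Dominated convergence in L^p when the bound is only dominated up to a
perturbation that tends to 0 in norm. *)
Lemma pnorm_dominated_cvg (u w : nat -> T -> R) h :
  (forall n, measurable_fun setT (u n)) -> (forall n, w n \in L) -> h \in L ->
  (forall n x, `|u n x| <= `|w n x| + `|h x|) ->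
  N (w n) @[n --> \oo] --> (0 : R) ->
  {ae mu, forall x, u n x @[n --> \oo] --> (0 : R)} ->
  N (u n) @[n --> \oo] --> (0 : R).
Proof.
move=> mu_ wL hL uwh w0 u0.
(* the part of u n that exceeds w n is dominated by h *)
pose k n x : R := Num.max (`|u n x| - `|w n x|) 0.
have k0 n x : 0 <= k n x by rewrite /k le_max lexx orbT.
have kh n x : `|k n x| <= `|h x|.
  by rewrite ger0_norm// /k ge_max normr_ge0 andbT lerBlDl uwh.
have ku n x : `|k n x| <= `|u n x|.
  by rewrite ger0_norm// /k ge_max normr_ge0 andbT lerBlDl lerDr.
have mk n : measurable_fun setT (k n).
  apply: measurable_maxr => //; apply: measurable_funB; apply: measurableT_comp => //.
  exact: Lfun_measurable.
have kL n : k n \in L by exact: (Lfun_le _ h).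
have nwL n : (fun x => `|w n x|) \in L.
  apply: (Lfun_le _ (w n)) => //; last by move=> x; rewrite normr_id.
  by apply: measurableT_comp => //; exact: Lfun_measurable.
have Nle n : N (u n) <= N (k n) + N (w n).
  apply: (@le_trans _ _ (N (fun x => k n x + `|w n x|))).
    apply: pnorm_le => //; last exact: LfunD.
    move=> x; rewrite [leRHS]ger0_norm ?addr_ge0//.
    by rewrite -lerBlDr /k le_max lexx.
  rewrite (le_trans (pnormD _ _ _ _))// lerD2l pnorm_le//.
  - exact: Lfun_measurable (nwL n).
  - by move=> x; rewrite normr_id.
have Ik : I (k n) @[n --> \oo] --> (0 : R).
  have := dominated_convergence measurableT
    (f_ := fun n x => (`|k n x| `^ p)%:E) (f := cst 0%E) _ _ _ (Lfun_pintegrable h hL) _.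
  case.
  - by move=> n; exact/measurable_EFinP/measurable_norm_powR.
  - exact: measurable_cst.
  - apply: filterS u0 => x ux _; apply: cvg_EFin; first exact: nearW.
    apply: (norm_powR_cvg0 p0).
    apply/cvgr0Pnorm_lt => e e0; move/cvgr0Pnorm_lt : ux => /(_ _ e0).
    by apply: filterS => n; apply: le_lt_trans.
  - apply/nearW => x n _; rewrite gee0_abs ?lee_fin ?powR_ge0//.
    by rewrite ge0_ler_powR ?nnegrE ?(ltW p0).
  move=> _ _; rewrite integral0 => h0; rewrite -[X in _ --> X]/(fine 0%E).
  exact: fine_cvg.
have Nk : N (k n) @[n --> \oo] --> (0 : R).
  under eq_fun do rewrite pnorm_powR -[X in X `^ _](ger0_norm (pint_ge0 _)).
  by apply: norm_powR_cvg0 Ik; rewrite invr_gt0.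
apply: (@squeeze_cvgr _ _ _ _ (fun=> 0) (fun n => N (k n) + N (w n))).
- by apply: nearW => n; rewrite pnorm_ge0 Nle.
- exact: cvg_cst.
- by rewrite -[X in _ --> X](addr0 (0 : R)); exact: cvgD.
Qed.

(** The p-th powers of the norms are summable, so the sum of the |w n|^p is
integrable, hence finite almost everywhere. *)
Lemma ae_cvg_pnorm (w : nat -> T -> R) : (forall n, w n \in L) ->
  (forall n, N (w n) <= (2 ^ n.+1)%:R^-1) ->
  {ae mu, forall x, w n x @[n --> \oo] --> (0 : R)}.
Proof.
move=> wL wN.
have wI n : I (w n) <= (2 ^ n.+1)%:R^-1.
  rewrite pint_pnorm (le_trans _ (wN n))//.
  have [->|w0] := eqVneq (N (w n)) 0; first by rewrite powR0.
  rewrite -[leRHS]powRr1 ?pnorm_ge0//; apply: ger_powR; last exact: ltW.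
  rewrite lt0r w0 pnorm_ge0/= (le_trans (wN n))//.
  by rewrite invf_le1 ?ltr0n ?expn_gt0// ler1n expn_gt0.
pose f n x := (`|w n x| `^ p)%:E.
have mf n : measurable_fun setT (f n).
  exact/measurable_EFinP/measurable_norm_powR/Lfun_measurable.
have f0 n x : (0 <= f n x)%E by rewrite lee_fin powR_ge0.
have int_f : mu.-integrable setT (fun x => \sum_(n <oo) f n x)%E.
  apply/integrableP; split.
    by apply: ge0_emeasurable_sum => // n x _ _.
  rewrite [ltLHS](_ : _ = \int[mu]_x \sum_(n <oo) f n x)%E; last first.
    by apply: eq_integral => x _; rewrite gee0_abs// nneseries_ge0.
  rewrite integral_nneseries//.
  apply: (@le_lt_trans _ _ (\sum_(n <oo) (((2 ^ n.+1)%:R^-1)%:E : \bar R))%E).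
    apply: lee_nneseries => [n _ _|n _]; first exact: integral_ge0.
    by rewrite /f -pintE// lee_fin.
  have := @cvg_geometric_eseries_half R 1 0.
  under eq_fun do rewrite addn1 div1r.
  by move/cvg_lim => ->//; rewrite ltry.
apply: filterS (integrable_ae measurableT int_f) => x /(_ Logic.I) fx.
have {}fx : (\sum_(n <oo) f n x < +oo)%E by rewrite ltey_eq fx.
have fx0e : f n x @[n --> \oo] --> (0%R)%:E.
  apply: (@squeeze_cvge _ _ _ _ (fun=> 0%E) _ (fun m => \sum_(m <= n <oo) f n x)%E).
  - apply: nearW => n; rewrite f0/=.
    rewrite (le_trans _ (nneseries_lim_ge (u_ := fun k => f k x) n.+1 _))//.
    by rewrite big_nat1.
  - exact: cvg_cst.
  - exact: nneseries_tail_cvg.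
have fx0 : `|w n x| `^ p @[n --> \oo] --> (0 : R) by exact: (fine_cvg fx0e).
have pV0 : 0 < p^-1 by rewrite invr_gt0.
apply/norm_cvg0P; have /= := norm_powR_cvg0 pV0 fx0.
under eq_fun do rewrite ger0_norm ?powR_ge0// -powRrM mulfV// powRr1//.
exact.
Qed.

(** If the integrals were equal, g - f, being nonnegative, would vanish almost
everywhere. *)
Lemma lt_Rintegral f g (A : set T) :
  mu.-integrable setT (EFin \o f) -> mu.-integrable setT (EFin \o g) ->
  (forall x, f x <= g x) -> measurable A -> (0 < mu A)%E ->
  (forall x, A x -> f x < g x) ->
  (\int[mu]_x f x < \int[mu]_x g x)%R.
Proof.
move=> fi gi fg mA A0 Afg; rewrite lt_neqAle le_Rintegral// andbT.
apply/eqP => E; move: A0; rewrite lt0e => /andP[/eqP + _]; apply.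
have gfi : mu.-integrable setT (EFin \o (fun x => g x - f x)).
  exact: (integrableB measurableT gi fi).
have : (\int[mu]_x `|(EFin \o (fun x => g x - f x)%R) x| = 0)%E.
  rewrite [LHS](_ : _ = \int[mu]_x (g x - f x)%:E)%E; last first.
    by apply: eq_integral => x _ /=; rewrite ger0_norm// subr_ge0.
  rewrite -[LHS]fineK; last exact: integrable_fin_num gfi.
  by rewrite -/(Rintegral mu setT (fun x => g x - f x)) RintegralB// E subrr.
move/(ae_eq_integral_abs mu measurableT (measurable_int _ gfi)).
case=> B [mB B0 sB]; apply: (subset_measure0 mA mB _ B0) => x Ax; apply: sB => /= h.
have := Afg x Ax; rewrite -subr_gt0.
by move: (h Logic.I) => [] ->; rewrite ltxx.
Qed.

Lemma pint_eq0 f : f \in L -> I f = 0 ->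
  {ae mu, forall x, f x = 0}.
Proof.
move=> fL f0; have N0 : N f = 0.
  by rewrite pnorm_powR f0 powR0// invr_neq0.
have mf : measurable_fun setT (EFin \o f).
  by apply/measurable_EFinP; exact: Lfun_measurable fL.
have h0 : ('N[mu]_(p%:E)[EFin \o f] = 0)%E by rewrite -pnormE// N0.
have h1 : (0 < p%:E)%E by rewrite lte_fin.
have := @Lnorm_eq0_eq0 _ _ _ mu _ _ mf h1 h0.
by apply: filterS => x /(_ Logic.I) [].
Qed.

Lemma ae_eq0_of_measure0 (D A : set T) f : measurable A -> mu A = 0%E ->
  (forall x, ~ A x -> f x = 0) -> f = cst 0 %[ae mu in D].
Proof.
move=> mA A0 fA; exists A; split => // x /= h; apply: contrapT => /fA fx; exact: h.
Qed.

Lemma integral_outside (D : set T) g : measurable D -> measurable_fun setT g ->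
  {ae mu, forall x, ~ D x -> g x = 0} ->
  (\int[mu]_(x in D) (g x)%:E = \int[mu]_x (g x)%:E)%E.
Proof.
move=> mD mg g0.
rewrite integral_mkcond; apply: ae_eq_integral => //.
- apply/(measurable_restrictT _ mD); apply/measurable_EFinP.
  exact: measurable_funTS.
- exact/measurable_EFinP.
- apply: filterS g0 => x gx _; rewrite patchE; case: ifPn => // /negP.
  by move=> nD; rewrite gx// => Dx; apply: nD; exact: mem_set.
Qed.

End Lp.

Arguments LnormE {d T R mu p}.
Arguments Lfun_measurable {d T R mu p}.
Arguments Lfun_Lnorm {d T R mu p}.
Arguments LfunI {d T R mu p}.
Arguments Lfun_Lnorm_fin {d T R mu p}.
Arguments pnormE {d T R mu p}.
Arguments pnorm_ge0 {d T R mu p}.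
Arguments Lfun_pintegrable {d T R mu p}.
Arguments pint_ge0 {d T R mu p}.
Arguments pintE {d T R mu p}.
Arguments pint_pnorm {d T R mu p}.
Arguments LfunD {d T R mu p}.
Arguments LfunZ {d T R mu p}.
Arguments LfunB {d T R mu p}.
Arguments Lfun_le {d T R mu p}.
Arguments pnormD {d T R mu p}.
Arguments pintZ {d T R mu p}.
Arguments pnorm_powR {d T R mu p}.
Arguments pnormZ {d T R mu p}.
Arguments pnormBC {d T R mu p}.
Arguments pnorm_le {d T R mu p}.
Arguments pnorm_dist {d T R mu p}.
Arguments pnorm_lin3_cvg {d T R mu p} p1 {J F FF}.
Arguments Lfun_lin3 {d T R mu p}.
Arguments pint_lin3_cvg {d T R mu p} p1 {J F FF}.
Arguments integrable_dpow {d T R mu p}.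
Arguments pint_convex {d T R mu p}.
Arguments pint_derivative {d T R mu p}.
Arguments pnorm_dominated_cvg {d T R mu p}.
Arguments ae_cvg_pnorm {d T R mu p}.
Arguments pint_eq0 {d T R mu p}.
Arguments ae_eq0_of_measure0 {d T R mu D}.
Arguments integral_outside {d T R mu}.
Arguments lin3 {d T R}.
Arguments lt_Rintegral {d T R mu}.

(** * Test functions *)

Section Ck.
Context (R : realType) (N : nat).
Local Notation E := 'rV[R]_N.
Implicit Types (f g : E -> R) (k : nat).

Lemma Ck_continuous k f : Ck k f -> continuous f.
Proof. by case: k => [|k] []. Qed.

Lemma CkW k f : Ck k.+1 f -> Ck k f.
Proof.
elim: k f => [|k IH] f [cf df]; first by split.
by split => // i; have [dfi Cfi] := df i; split => //; exact: IH.
Qed.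

Lemma Ck_cst k (c : R) : Ck k (fun _ : E => c).
Proof.
elim: k c => [|k IH] c; first by split => //; exact: cst_continuous.
split => [|i]; first exact: cst_continuous.
split => [x|]; first exact: derivable_cst.
by under eq_fun do rewrite (derive_cst c); exact: IH.
Qed.

Lemma CkD k f g : Ck k f -> Ck k g -> Ck k (fun x => f x + g x).
Proof.
elim: k f g => [|k IH] f g [cf df] [cg dg].
  by split => // x; exact: (cvgD (cf x) (cg x)).
split => [x|i]; first by exact: (cvgD (cf x) (cg x)).
have [dfi Cf] := df i; have [dgi Cg] := dg i; split => [x|].
  by apply: derivableD; [exact: dfi|exact: dgi].
rewrite (_ : (fun x => _) =
  (fun x => 'D_(delta_mx 0 i) f x + 'D_(delta_mx 0 i) g x)); first exact: IH.
by apply/funext => x; rewrite -deriveD.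
Qed.

Lemma CkM k f g : Ck k f -> Ck k g -> Ck k (fun x => f x * g x).
Proof.
elim: k f g => [|k IH] f g Cf Cg; have cf := Ck_continuous _ _ Cf;
  have cg := Ck_continuous _ _ Cg.
  by split => // x; exact: (cvgM (cf x) (cg x)).
split => [x|i]; first by exact: (cvgM (cf x) (cg x)).
have [dfi Cfi] := (proj2 Cf) i; have [dgi Cgi] := (proj2 Cg) i; split => [x|].
  by apply: derivableM; [exact: dfi|exact: dgi].
rewrite (_ : (fun x => _) =
  (fun x => f x * 'D_(delta_mx 0 i) g x + g x * 'D_(delta_mx 0 i) f x)).
  by apply: CkD; apply: IH => //; exact: CkW.
by apply/funext => x; rewrite -[RHS]deriveM.
Qed.

(** The chain rule along the line through x with direction v. *)
Lemma is_derive_powR f (x v : E) (df a : R) : 0 < f x -> is_derive x v f df ->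
  is_derive x v (fun y => f y `^ a) (a * f x `^ (a - 1) * df).
Proof.
move=> fx0 [dfx <-].
have line (g : E -> R) : 'D_v g x = 'D_1 (fun h : R => g (h *: v + x)) 0.
  rewrite /derive; set g1 := fun h => h^-1 *: _; set g2 := fun h => h^-1 *: _.
  suff -> : g1 = g2 by [].
  by rewrite funeqE /g1 /g2 => h /=; rewrite addr0 scale0r add0r [_%:A]mulr1.
have dl : is_derive (0 : R) 1 (fun h : R => f (h *: v + x)) ('D_v f x).
  by apply: DeriveDef; [exact: (derivable1P _ _ _).1|rewrite line].
have f0 : f (0 *: v + x) = f x by rewrite scale0r add0r.
have dp : is_derive (f (0 *: v + x)) 1 (@powR R ^~ a) (a * f x `^ (a - 1)).
  by rewrite f0; exact: is_derive1_powR.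
have := @is_derive1_comp R (@powR R ^~ a) (fun h : R => f (h *: v + x)) 0 _ _ dp dl.
move=> [d1 d2]; apply: DeriveDef; first exact: (derivable1P _ _ _).2.
by rewrite line -d2.
Qed.

(** All exponents are treated at once, since a derivative of f^a is a multiple
of f^(a - 1). *)
Lemma Ck_powR k f (a : R) : (forall x, 0 < f x) -> Ck k f -> Ck k (fun x => f x `^ a).
Proof.
move=> f0; have cp (b : R) : continuous f -> continuous (fun x => f x `^ b).
  move=> cf; rewrite (_ : (fun x => _) = (fun t : R => `|t| `^ b) \o f).
    move=> x; apply: continuous_comp; first exact: cf.
    by apply: continuous_norm_powR_neq0; rewrite gt_eqF.
  by apply/funext => x /=; rewrite gtr0_norm.
elim: k a => [|k IH] a Cf; have cf := Ck_continuous _ _ Cf.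
  by split => //; exact: cp.
split => [|i]; first exact: cp.
have [dfi Cfi] := (proj2 Cf) i.
have d x := is_derive_powR f x (delta_mx 0 i) _ a (f0 x) (derivableP (dfi x)).
split => [x|]; first by case: (d x).
rewrite (_ : (fun x => _) = (fun x => a * f x `^ (a - 1) * 'D_(delta_mx 0 i) f x)).
  by apply: CkM => //; apply: CkM; [exact: Ck_cst|apply: IH; exact: CkW].
by apply/funext => x; case: (d x).
Qed.

End Ck.

Arguments CkD {R N k}.
Arguments CkM {R N k}.
Arguments Ck_cst {R N k}.
Arguments Ck_powR {R N k}.

(** A smooth 1-Lipschitz approximation of max(t, 0) within e, vanishing
at 0 so that composing with it does not enlarge supports. *)
Definition smooth_max0 {R : realType} (e t : R) : R :=
  2^-1 * ((t * t + e * e) `^ 2^-1 + t + - e).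

Section smooth_max0.
Context (R : realType).
Implicit Types e t : R.

Let sqE e t : (t * t + e * e) `^ 2^-1 = Num.sqrt (t * t + e * e).
Proof. by rewrite powR12_sqrt// addr_ge0// -expr2 sqr_ge0. Qed.

Lemma smooth_max00 e : 0 < e -> smooth_max0 e 0 = 0.
Proof.
move=> e0; rewrite /smooth_max0 sqE mul0r add0r -expr2 sqrtr_sqr gtr0_norm//.
by rewrite addr0 subrr mulr0.
Qed.

Lemma smooth_max0_lip e a b : 0 < e ->
  `|smooth_max0 e a - smooth_max0 e b| <= `|a - b|.
Proof.
move=> e0; rewrite /smooth_max0 !sqE.
set A := Num.sqrt _; set B := Num.sqrt _.
have sA : A * A = a * a + e * e.
  by rewrite -expr2 sqr_sqrtr// addr_ge0// -expr2 sqr_ge0.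
have sB : B * B = b * b + e * e.
  by rewrite -expr2 sqr_sqrtr// addr_ge0// -expr2 sqr_ge0.
have A0 : 0 <= A by exact: sqrtr_ge0.
have B0 : 0 <= B by exact: sqrtr_ge0.
have AB : `|A - B| <= `|a - b|.
  rewrite -ler_sqr ?nnegrE// !real_normK ?num_real// !expr2.
  have ab : a * b + e * e <= A * B.
    apply: le_trans (ler_norm _) _.
    rewrite -[leRHS]ger0_norm ?mulr_ge0// -ler_sqr ?nnegrE//.
    rewrite !real_normK ?num_real// !expr2.
    have -> : A * B * (A * B) = (A * A) * (B * B) by ring.
    rewrite sA sB; have := sqr_ge0 (a * e - b * e); rewrite expr2; lra.
  lra.
have -> : 2^-1 * (A + a + - e) - 2^-1 * (B + b + - e) = 2^-1 * ((A - B) + (a - b)).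
  by ring.
rewrite normrM ger0_norm ?invr_ge0//.
have := ler_normD (A - B) (a - b); lra.
Qed.

Lemma smooth_max0_approx e t : 0 < e -> `|smooth_max0 e t - Num.max t 0| <= e.
Proof.
move=> e0; rewrite /smooth_max0 sqE.
have n0 := normr_ge0 t.
have nn : `|t| * `|t| = t * t by rewrite -!expr2 real_normK ?num_real.
have mE : Num.max t 0 = 2^-1 * (`|t| + t).
  by case: (leP t 0) => t0; [rewrite ler0_norm|rewrite gtr0_norm] => //; lra.
have h1 : `|t| <= Num.sqrt (t * t + e * e).
  by rewrite -sqrtr_sqr ler_wsqrtr// expr2 lerDl -expr2 sqr_ge0.
have h2 : Num.sqrt (t * t + e * e) <= `|t| + e.
  rewrite -[leRHS]ger0_norm ?addr_ge0 ?(ltW e0)// -sqrtr_sqr ler_wsqrtr// expr2.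
  nra.
rewrite mE ler_norml; apply/andP; split; lra.
Qed.

Lemma Ck_smooth_max0 (N k : nat) e (f : 'rV[R]_N -> R) : 0 < e -> Ck k f ->
  Ck k (fun x => smooth_max0 e (f x)).
Proof.
move=> e0 Cf; apply: CkM; first exact: Ck_cst.
apply: CkD; last exact: Ck_cst.
apply: CkD => //; apply: Ck_powR => [x|].
  by rewrite ltr_wpDl ?mulr_gt0// -expr2 sqr_ge0.
by apply: CkD; [exact: CkM|exact: Ck_cst].
Qed.

End smooth_max0.

Section Cc_infty.
Context (R : realType) (N : nat) (Omega : set 'rV[R]_N).
Implicit Types f g : 'rV[R]_N -> R.

Lemma Cc_infty_smooth_max0 e f : 0 < e -> Cc_infty Omega f ->
  Cc_infty Omega (fun x => smooth_max0 e (f x)).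
Proof.
move=> e0 [Cf [cf fO]].
have sub : closure [set x | smooth_max0 e (f x) != 0] `<=` closure [set x | f x != 0].
  apply: closure_subset => x /=; apply: contra => /eqP ->.
  by rewrite smooth_max00.
split => [k|]; first exact: Ck_smooth_max0.
split; last exact: subset_trans fO.
by apply: subclosed_compact cf sub; exact: closed_closure.
Qed.

Lemma Cc_infty_lin a b f g : Cc_infty Omega f -> Cc_infty Omega g ->
  Cc_infty Omega (fun x => a * f x + b * g x).
Proof.
move=> [Cf [cf fO]] [Cg [cg gO]].
have sub : closure [set x | a * f x + b * g x != 0] `<=`
    closure [set x | f x != 0] `|` closure [set x | g x != 0].
  rewrite -closureU; apply: closure_subset => x /=.
  have [->|] := eqVneq (f x) 0; last by left.
  have [->|] := eqVneq (g x) 0; last by right.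
  by rewrite !mulr0 addr0 eqxx.
split => [k|]; first by apply: CkD; apply: CkM => //; exact: Ck_cst.
split; last by move=> x /sub[/fO|/gO].
apply: subclosed_compact sub; first exact: closed_closure.
exact: compactU.
Qed.

End Cc_infty.

(** * The Sobolev space as a subspace of two L^p spaces *)

(** The Gagliardo seminorm of u is the L^p norm of this function, which is
linear in u. *)
Definition quo {R : realType} {N : nat} (s p : R) (u : 'rV[R]_N -> R)
    (z : 'rV[R]_N * 'rV[R]_N) : R :=
  (u z.1 - u z.2) / eucl (z.1 - z.2) `^ ((N%:R + p * s) / p).

Section sobolev.
Context (R : realType) (N : nat) (s p : R).
Hypothesis p1 : 1 < p.
Local Notation E := 'rV[R]_N.
Local Notation mu := (lebesgue_rV R N).
Local Notation mu2 := ((mu \x mu)%E : {measure set (E * E) -> \bar R}).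
Implicit Types (u v w xi : E -> R) (Omega : set E).

Let p0 : 0 < p. Proof. exact: lt_trans p1. Qed.
Let pn0 : p != 0. Proof. by rewrite gt_eqF. Qed.

Local Notation Q := (quo s p).

Lemma quo_lin (a b : R) u v z : Q (fun x => a * u x + b * v x) z = a * Q u z + b * Q v z.
Proof. by rewrite /quo; ring. Qed.

Lemma quoB u v z : Q (fun x => u x - v x) z = Q u z - Q v z.
Proof. by rewrite /quo; ring. Qed.

Lemma quo_le u v z : `|u z.1 - u z.2| <= `|v z.1 - v z.2| -> `|Q u z| <= `|Q v z|.
Proof. by move=> uv; rewrite /quo !normrM ler_wpM2r. Qed.

Lemma quo_powR u z :
  `|Q u z| `^ p = `|u z.1 - u z.2| `^ p / eucl (z.1 - z.2) `^ (N%:R + p * s).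
Proof.
rewrite /quo normrM powRM//; congr (_ * _).
by rewrite -powRN ger0_norm ?powR_ge0// -powRrM mulNr divfK// powRN.
Qed.

Lemma eucl_gt0 (x : E) : x != 0 -> 0 < eucl x.
Proof.
move=> x0; rewrite /eucl sqrtr_gt0 lt0r sumr_ge0 ?andbT; last first.
  by move=> i _; exact: sqr_ge0.
apply: contra x0 => /eqP/psumr_eq0P h; apply/eqP/rowP => i; rewrite mxE.
by apply/eqP; rewrite -sqrf_eq0; apply/eqP/h => // j _; exact: sqr_ge0.
Qed.

(** The powers of the distance add up to N + p s; on the diagonal z.1 = z.2
both sides vanish. *)
Lemma quo_dpow u xi z : dpow p (Q u z) * Q xi z =
  `|u z.1 - u z.2| `^ (p - 2) * (u z.1 - u z.2) * (xi z.1 - xi z.2)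
      / eucl (z.1 - z.2) `^ (N%:R + p * s).
Proof.
have [z12|z12] := eqVneq (z.1 - z.2) 0.
  have zz : z.1 = z.2 by apply/eqP; rewrite -subr_eq0 z12.
  by rewrite /dpow /quo zz !subrr !(mul0r, mulr0).
have e0 := eucl_gt0 _ z12; set e := eucl _ in e0 *.
set c := N%:R + p * s.
rewrite /dpow /quo -/e -/c normrM powRM// -powRN (ger0_norm (powR_ge0 _ _)) -powRrM.
set a := `|_| `^ _; set du := u _ - _; set dx := xi _ - _.
rewrite -[_ / e `^ c]mulrC -powRN.
have -> : e `^ (- c) = e `^ (- (c / p) * (p - 2)) * (e `^ (- (c / p)) * e `^ (- (c / p))).
  rewrite -!powRD ?(gt_eqF e0) ?implybT//; congr (_ `^ _); by field.
ring.
Qed.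

Lemma measurable_eucl_sub : measurable_fun setT (fun z : E * E => eucl (z.1 - z.2)).
Proof.
rewrite /eucl; apply: (measurableT_comp (continuous_measurable_fun (@sqrt_continuous R))).
apply: measurable_sum => i; apply: measurable_funX.
rewrite (_ : (fun z : E * E => _) = (fun z => z.1 0 i - z.2 0 i)); last first.
  by apply/funext => z; rewrite !mxE.
apply: measurable_funB.
  apply: (@measurableT_comp _ _ _ _ _ _ (fun x : E => x 0 i) _ fst) => //.
  exact: measurable_rV_coord.
apply: (@measurableT_comp _ _ _ _ _ _ (fun x : E => x 0 i) _ snd) => //.
exact: measurable_rV_coord.
Qed.

Lemma measurable_quo u : measurable_fun setT u -> measurable_fun setT (Q u).
Proof.
move=> mu_; rewrite /quo.
rewrite (_ : (fun z => _) = fun z : E * E => (u z.1 - u z.2) *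
    eucl (z.1 - z.2) `^ (- ((N%:R + p * s) / p))); last first.
  by apply/funext => z; rewrite powRN.
apply: measurable_funM.
  apply: measurable_funB; first exact: (measurableT_comp mu_ measurable_fst).
  exact: (measurableT_comp mu_ measurable_snd).
by apply: (measurableT_comp (measurable_powR _)); exact: measurable_eucl_sub.
Qed.

Lemma gagliardoE u : gagliardo s p u = 'N[mu2]_(p%:E)[EFin \o Q u]%E.
Proof.
rewrite /gagliardo LnormE; congr (_ `^ _)%E; apply: eq_integral => z _.
by rewrite quo_powR.
Qed.

Lemma sobolevP u : sobolev s p u <-> u \in Lfun mu p%:E /\ Q u \in Lfun mu2 p%:E.
Proof.
rewrite /sobolev /= gagliardoE; split => -[uL].
  move=> Qu; split => //; rewrite inE; apply/andP; split; rewrite inE//=.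
  exact: measurable_quo (Lfun_measurable _ uL).
by move=> /Lfun_Lnorm.
Qed.

(** The real value of sobolev_norm, which is finite on the Sobolev space. *)
Definition snorm u : R := pnorm mu p u + pnorm mu2 p (Q u).

Lemma snormE u : sobolev s p u -> sobolev_norm s p u = (snorm u)%:E.
Proof.
by move=> /sobolevP[uL QL]; rewrite /sobolev_norm gagliardoE -!pnormE.
Qed.

Lemma snorm_ge0 u : 0 <= snorm u.
Proof. by rewrite addr_ge0// pnorm_ge0. Qed.

Lemma sobolev_lin (a b : R) u v : sobolev s p u -> sobolev s p v ->
  sobolev s p (fun x => a * u x + b * v x).
Proof.
move=> /sobolevP[uL QuL] /sobolevP[vL QvL]; apply/sobolevP; split.
  by apply: LfunD => //; exact: LfunZ.
by rewrite (funext (quo_lin a b u v)); apply: LfunD => //; exact: LfunZ.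
Qed.

Lemma snorm_lin_le (a b : R) u v : sobolev s p u -> sobolev s p v ->
  snorm (fun x => a * u x + b * v x) <= `|a| * snorm u + `|b| * snorm v.
Proof.
move=> /sobolevP[uL QuL] /sobolevP[vL QvL].
have -> : `|a| * snorm u + `|b| * snorm v =
  (`|a| * pnorm mu p u + `|b| * pnorm mu p v) +
  (`|a| * pnorm mu2 p (Q u) + `|b| * pnorm mu2 p (Q v)) by rewrite /snorm; ring.
rewrite /snorm (funext (quo_lin a b u v)) -!pnormZ//.
by apply: lerD; apply: pnormD => //; exact: LfunZ.
Qed.

Lemma sobolevB u v : sobolev s p u -> sobolev s p v -> sobolev s p (fun x => u x - v x).
Proof.
move=> su sv; have := sobolev_lin 1 (-1) u v su sv.
by under eq_fun do rewrite mul1r mulN1r.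
Qed.

Lemma sobolev_norm_lt u (e : R) : measurable_fun setT u ->
  (sobolev_norm s p u < e%:E)%E -> sobolev s p u /\ snorm u < e.
Proof.
move=> mu_ ue; have su : sobolev s p u.
  have := lt_trans ue (ltry e); rewrite /sobolev_norm gagliardoE => h.
  apply/sobolevP; split; rewrite inE; apply/andP; split; rewrite inE//=.
  - by apply: le_lt_trans h; rewrite leeDl// Lnorm_ge0.
  - exact: measurable_quo.
  - by apply: le_lt_trans h; rewrite leeDr// Lnorm_ge0.
by split => //; move: ue; rewrite snormE// lte_fin.
Qed.


End sobolev.

Arguments quo_lin {R N}.
Arguments quoB {R N}.
Arguments quo_le {R N s p}.
Arguments quo_powR {R N}.
Arguments eucl_gt0 {R N}.
Arguments quo_dpow {R N}.
Arguments measurable_quo {R N}.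
Arguments sobolevP {R N s p}.
Arguments snorm {R N}.
Arguments snormE {R N s p}.
Arguments snorm_ge0 {R N s p}.
Arguments sobolev_lin {R N s p}.
Arguments snorm_lin_le {R N s p}.
Arguments sobolevB {R N s p}.
Arguments sobolev_norm_lt {R N s p}.
Arguments gagliardoE {R N s p}.

(** * The closure of the test functions is a vector lattice *)

Section sobolev0.
Context (R : realType) (N : nat) (s p : R) (Omega : set 'rV[R]_N).
Hypothesis p1 : 1 < p.
Local Notation E := 'rV[R]_N.
Local Notation mu := (lebesgue_rV R N).
Local Notation mu2 := ((mu \x mu)%E : {measure set (E * E) -> \bar R}).
Local Notation Q := (quo s p).
Local Notation W0 := (sobolev0 s p Omega).
Local Notation sn := (snorm s p).
Implicit Types (u v w phi : E -> R).

Lemma continuous_measurable_rV u : continuous u -> measurable_fun setT u.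
Proof.
move=> cu; apply: (measurability _ (RGenOpens.measurableE R)).
move=> _ [_ [a [b ->] <-]]; rewrite setTI; apply: measurable_rV_open.
by move/continuousP : cu; apply; exact: interval_open.
Qed.

(** A null set times the whole space is null for the product measure, even
when the whole space has infinite measure. *)
Lemma ae_prod (P : E -> Prop) : {ae mu, forall x, P x} ->
  {ae mu2, forall z, P z.1 /\ P z.2}.
Proof.
case=> A [mA A0 PA].
have n1 : mu2.-negligible (A `*` setT).
  apply/negligibleP; first exact: measurableX.
  by transitivity (mu A * mu setT)%E; [exact: product_measure1E|rewrite A0 mul0e].
have n2 : mu2.-negligible (setT `*` A).
  apply/negligibleP; first exact: measurableX.
  by transitivity (mu setT * mu A)%E; [exact: product_measure1E|rewrite A0 mule0].
have [B [mB B0 sB]] := negligibleU n1 n2.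
exists B; split => // z /= /not_andP[/PA|/PA] h; apply: sB; [by left|by right].
Qed.

Lemma sobolev0_sobolev u : W0 u -> sobolev s p u.
Proof. by case. Qed.

Lemma sobolev0P u : W0 u <-> sobolev s p u /\ forall e : R, 0 < e ->
  exists phi, [/\ Cc_infty Omega phi, sobolev s p phi & sn (fun x => u x - phi x) < e].
Proof.
split=> -[su h]; (split; first exact: su) => e /h.
  move=> [phi Cphi ue]; exists phi.
  have mu_ : measurable_fun setT u by move/(sobolevP p1) : su => [/Lfun_measurable].
  have mphi : measurable_fun setT phi.
    by apply: continuous_measurable_rV; exact: (Ck_continuous _ _ _ _ (Cphi.1 0%N)).
  have [sw lt_e] := sobolev_norm_lt p1 _ e (measurable_funB mu_ mphi) ue.
  split; [exact: Cphi| |exact: lt_e].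
  have := sobolevB p1 _ _ su sw.
  by rewrite (_ : (fun x => _) = phi); [exact|apply/funext => x /=; rewrite subKr].
move=> [phi [Cphi sphi lt_e]]; exists phi; first exact: Cphi.
by rewrite (snormE p1) ?lte_fin; [exact: lt_e|exact: sobolevB].
Qed.

Lemma sobolev0_lin (a b : R) u v : W0 u -> W0 v -> W0 (fun x => a * u x + b * v x).
Proof.
move=> /sobolev0P[su hu] /sobolev0P[sv hv]; apply/sobolev0P.
split; first exact: sobolev_lin.
move=> e e0; pose M : R := `|a| + `|b| + 1.
have M0 : 0 < M by rewrite ltr_wpDl// addr_ge0.
have eM : 0 < e / M by rewrite divr_gt0.
have [f [Cf sf ltf]] := hu _ eM; have [g [Cg sg ltg]] := hv _ eM.
exists (fun x => a * f x + b * g x); split; first exact: Cc_infty_lin.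
  exact: sobolev_lin.
rewrite (_ : (fun x => _) = fun x => a * (u x - f x) + b * (v x - g x)); last first.
  by apply/funext => x; ring.
have sub1 := sobolevB p1 _ _ su sf; have sub2 := sobolevB p1 _ _ sv sg.
apply: le_lt_trans (snorm_lin_le p1 a b _ _ sub1 sub2) _.
have -> : e = (e / M) * `|a| + (e / M) * `|b| + (e / M).
  by rewrite /M; field; rewrite gt_eqF.
apply: (@le_lt_trans _ _ (e / M * `|a| + e / M * `|b|)); last by rewrite ltrDl.
by apply: lerD; rewrite mulrC ler_wpM2r ?normr_ge0// ltW.
Qed.

(** The geometric rate makes the approximation converge almost everywhere
without extracting a subsequence. *)
Lemma sobolev0_seq u : W0 u -> exists phi : nat -> E -> R,
  [/\ forall n, Cc_infty Omega (phi n), forall n, sobolev s p (phi n) &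
      forall n, sn (fun x => u x - phi n x) <= (2 ^ n.+1)%:R^-1].
Proof.
move=> /sobolev0P[su h].
have /choice[phi Hphi] : forall n : nat, exists phi, [/\ Cc_infty Omega phi,
    sobolev s p phi & sn (fun x => u x - phi x) <= (2 ^ n.+1)%:R^-1].
  move=> n; have [|phi [? ? /ltW]] := h ((2 ^ n.+1)%:R^-1).
    by rewrite invr_gt0 ltr0n expn_gt0.
  by exists phi.
by exists phi; split => n; have [] := Hphi n.
Qed.

Lemma sobolev0_seq_ae u (phi : nat -> E -> R) : sobolev s p u ->
  (forall n, sobolev s p (phi n)) ->
  (forall n, sn (fun x => u x - phi n x) <= (2 ^ n.+1)%:R^-1) ->
  {ae mu, forall x, phi n x @[n --> \oo] --> u x}.
Proof.
move=> su sphi uphi.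
have swn n := sobolevB p1 _ _ su (sphi n).
have := ae_cvg_pnorm p1 (fun n x => u x - phi n x) (fun n => ((sobolevP p1 _).1 (swn n)).1).
case; last first.
  move=> A hA; exists A; case: hA => mA A0 sA; split => // x /= h; apply: sA => /= h'.
  apply: h; rewrite (_ : (fun n => _) = (fun n => u x - (u x - phi n x))); last first.
    by apply/funext => n; rewrite subKr.
  rewrite -[X in _ --> X]subr0; apply: cvgB => //; exact: cvg_cst.
by move=> n; apply: le_trans (uphi n); rewrite /snorm lerDl pnorm_ge0.
Qed.

(** Test functions vanish outside Omega, hence so do their limits. *)
Lemma sobolev0_outside u : W0 u -> {ae mu, forall x, ~ Omega x -> u x = 0}.
Proof.
move=> W0u; have [phi [Cphi sphi uphi]] := sobolev0_seq u W0u.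
have := sobolev0_seq_ae u phi (sobolev0_sobolev u W0u) sphi uphi.
apply: filterS => x ux Ox; apply/esym; apply: cvg_unique ux => //.
rewrite (_ : (fun n => _) = fun=> 0); first exact: cvg_cst.
apply/funext => n; apply/eqP/negPn/negP => phix; apply: Ox.
by apply: (Cphi n).2.2; exact: subset_closure.
Qed.

(** The truncation max(v, 0) is approximated by smoothed truncations of the
test functions phi n that approximate v; these are again test functions. The
error D n and its quotient tend to 0 almost everywhere, and since truncations
are 1-Lipschitz they are dominated by those of 2 v, up to those of v - phi n. *)
Lemma sobolev0_pospart v : W0 v -> W0 (pospart v).
Proof.
move=> W0v; have sv := sobolev0_sobolev v W0v.
have [vL QvL] := (sobolevP p1 _).1 sv.
have [phi [Cphi sphi uphi]] := sobolev0_seq v W0v.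
have aephi := sobolev0_seq_ae v phi sv sphi uphi.
have mv : measurable_fun setT (pospart v).
  by apply: measurable_maxr => //; exact: Lfun_measurable vL.
have pos_lip a b : `|Num.max a 0 - Num.max b 0| <= `|a - b| :> R.
  by case: (leP a 0) => ?; case: (leP b 0) => ?; rewrite ler_norml; apply/andP;
    split; have := ler_norm (a - b); have := ler_norm (b - a); rewrite (distrC b a); lra.
have spos : sobolev s p (pospart v).
  apply/(sobolevP p1); split.
    apply: (Lfun_le p1 _ v) => // x.
    by have := pos_lip (v x) 0; rewrite maxxx !subr0.
  apply: (Lfun_le p1 _ (Q v)) => //; first exact: measurable_quo.
  by move=> z; apply: quo_le; exact: pos_lip.
pose e n : R := n.+1%:R^-1.
have e0 n : 0 < e n by rewrite invr_gt0.
pose psi n x := smooth_max0 (e n) (phi n x).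
have Cpsi n : Cc_infty Omega (psi n) by exact: Cc_infty_smooth_max0.
have mpsi n : measurable_fun setT (psi n).
  by apply: continuous_measurable_rV; exact: (Ck_continuous _ _ _ _ ((Cpsi n).1 0%N)).
have spsi n : sobolev s p (psi n).
  have [phiL QphiL] := (sobolevP p1 _).1 (sphi n).
  apply/(sobolevP p1); split.
    apply: (Lfun_le p1 _ (phi n)) => // x.
    by have := smooth_max0_lip R (e n) (phi n x) 0 (e0 n); rewrite smooth_max00// !subr0.
  apply: (Lfun_le p1 _ (Q (phi n))) => //; first exact: measurable_quo.
  by move=> z; apply: quo_le; exact: smooth_max0_lip.
pose D n x := pospart v x - psi n x.
pose w n x := v x - phi n x.
have swn n : sobolev s p (w n) := sobolevB p1 _ _ sv (sphi n).
have mD n : measurable_fun setT (D n) by exact: measurable_funB.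
have D0 x : phi n x @[n --> \oo] --> v x -> D n x @[n --> \oo] --> (0 : R).
  move=> phix.
  have H n : `|D n x| <= `|v x - phi n x| + e n.
    rewrite /D (_ : _ - _ = (Num.max (v x) 0 - Num.max (phi n x) 0) +
      (Num.max (phi n x) 0 - psi n x)); last by rewrite /pospart; ring.
    apply: le_trans (ler_normD _ _) _; apply: lerD; first exact: pos_lip.
    by rewrite distrC; exact: smooth_max0_approx.
  apply/norm_cvg0P; apply: (@squeeze_cvgr _ _ _ _ (fun=> 0) (fun n => `|v x - phi n x| + e n)).
  - by apply: nearW => n; rewrite normr_ge0 H.
  - exact: cvg_cst.
  - rewrite -[X in _ --> X](addr0 (0 : R)); apply: cvgD; last exact: cvg_harmonic.
    rewrite -(normr0 R) -(subrr (v x)); apply: cvg_norm; apply: cvgB => //; exact: cvg_cst.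
have w0 : sn (w n) @[n --> \oo] --> (0 : R).
  apply: (@squeeze_cvgr _ _ _ _ (fun=> 0) (fun n => (2 ^ n.+1)%:R^-1)).
  - by apply: nearW => n; rewrite snorm_ge0 uphi.
  - exact: cvg_cst.
  - apply: (@squeeze_cvgr _ _ _ _ (fun=> 0) (fun n => n.+1%:R^-1)).
    + apply: nearW => n; rewrite invr_ge0 ler0n/=.
      by rewrite lef_pV2 ?posrE ?ltr0n ?expn_gt0// ler_nat ltnW// ltn_expl.
    + exact: cvg_cst.
    + exact: cvg_harmonic.
have w1 : pnorm mu p (w n) @[n --> \oo] --> (0 : R).
  apply: (@squeeze_cvgr _ _ _ _ (fun=> 0) (fun n => sn (w n))) => //; last exact: cvg_cst.
  by apply: nearW => n; rewrite pnorm_ge0 lerDl pnorm_ge0.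
have w2 : pnorm mu2 p (Q (w n)) @[n --> \oo] --> (0 : R).
  apply: (@squeeze_cvgr _ _ _ _ (fun=> 0) (fun n => sn (w n))) => //; last exact: cvg_cst.
  by apply: nearW => n; rewrite pnorm_ge0 lerDr pnorm_ge0.
have D_le (a b c d : R) : `|a| <= `|b| -> `|c| <= `|d| ->
    `|a - c| <= `|b - d| + `|2 * b|.
  move=> ab cd; have := ler_normB a c; have := ler_normB b (b - d).
  by rewrite subKr normrM ger0_norm//; lra.
have N1 : pnorm mu p (D n) @[n --> \oo] --> (0 : R).
  apply: (pnorm_dominated_cvg p1 D w (fun x => 2 * v x)) => //.
  - by move=> n; exact: ((sobolevP p1 _).1 (swn n)).1.
  - exact: LfunZ.
  - move=> n x; have := pos_lip (v x) 0; rewrite maxxx !subr0 => h1.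
    have := smooth_max0_lip R (e n) (phi n x) 0 (e0 n); rewrite smooth_max00// !subr0 => h2.
    exact: D_le h1 h2.
  - by apply: filterS aephi => x; exact: D0.
have N2 : pnorm mu2 p (Q (D n)) @[n --> \oo] --> (0 : R).
  apply: (pnorm_dominated_cvg p1 (fun n => Q (D n)) (fun n => Q (w n)) (fun z => 2 * Q v z)) => //.
  - by move=> n; exact: measurable_quo.
  - by move=> n; exact: ((sobolevP p1 _).1 (swn n)).2.
  - exact: LfunZ.
  - move=> n z; rewrite /D /w !(quoB s p); apply: D_le.
      by apply: quo_le; exact: pos_lip.
    by apply: quo_le; exact: smooth_max0_lip.
  - apply: filterS (ae_prod _ aephi) => z [z1 z2].
    rewrite /quo -(mul0r (eucl (z.1 - z.2) `^ ((N%:R + p * s) / p))^-1).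
    apply: cvgM; last exact: cvg_cst.
    rewrite -[X in _ --> X](subrr (0 : R)); apply: cvgB; exact: D0.
apply/sobolev0P; split; first exact: spos.
move=> r r0.
have : sn (D n) @[n --> \oo] --> (0 : R).
  by rewrite -[X in _ --> X](addr0 (0 : R)); exact: cvgD.
move/cvgr0Pnorm_lt => /(_ _ r0)[n _ /(_ n (leqnn n))] /=.
rewrite ger0_norm ?snorm_ge0// => Dr.
by exists (psi n); split; [exact: Cpsi|exact: spsi|exact: Dr].
Qed.

Lemma sobolev0_negpart v : W0 v -> W0 (negpart v).
Proof.
move=> W0v; have h := sobolev0_pospart _ (sobolev0_lin (-1) 0 v v W0v W0v).
rewrite (_ : negpart v = fun x => -1 * pospart (fun x => -1 * v x + 0 * v x) x + 0 * v x).
  exact: sobolev0_lin.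
apply/funext => x; rewrite /negpart /pospart !mul0r !addr0 !mulN1r.
by rewrite -{2}oppr0 -oppr_min opprK.
Qed.

End sobolev0.

Arguments ae_prod {R N}.
Arguments sobolev0_sobolev {R N s p Omega u}.
Arguments sobolev0_lin {R N s p Omega}.
Arguments sobolev0_outside {R N s p Omega}.
Arguments sobolev0_pospart {R N s p Omega}.
Arguments sobolev0_negpart {R N s p Omega}.

(** * Upper bounds for the second eigenvalue *)

Lemma compact_S1 (R : realType) : compact (@S1 R).
Proof.
pose I : set R := `[-1, 1]%classic.
apply: (@subclosed_compact (R * R)%type (@S1 R) (I `*` I)).
- apply: (@preimage_closed _ _ (fun t : R * R => t.1 ^+ 2 + t.2 ^+ 2) [set 1]).
    move=> t _; apply: cvgD.
      by apply: (@continuous_comp _ _ _ fst (fun a : R => a ^+ 2) t);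
        [exact: cvg_fst|exact: exprn_continuous].
    by apply: (@continuous_comp _ _ _ snd (fun a : R => a ^+ 2) t);
      [exact: cvg_snd|exact: exprn_continuous].
  exact: closed_eq.
- by apply: compact_setX; exact: segment_compact.
- move=> [a b]; rewrite /S1 /= => ab.
  have := sqr_ge0 a; have := sqr_ge0 b; rewrite !expr2 in ab *.
  move=> b0 a0; split; rewrite /I /= in_itv/=; apply/andP; split; nra.
Qed.

Section lambda2.
Context (R : realType) (N : nat) (s p : R) (Omega : set 'rV[R]_N).
Hypothesis p1 : 1 < p.
Local Notation E := 'rV[R]_N.
Local Notation mu := (lebesgue_rV R N).
Local Notation mu2 := ((mu \x mu)%E : {measure set (E * E) -> \bar R}).
Local Notation Q := (quo s p).
Local Notation W0 := (sobolev0 s p Omega).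
Local Notation sn := (snorm s p).
Implicit Types (u v w : E -> R) (t : R * R).

Lemma gagliardo_poweR u : sobolev s p u ->
  (gagliardo s p u `^ p = (pint mu2 p (Q u))%:E)%E.
Proof.
by move=> /(sobolevP p1)[_ QL]; rewrite (gagliardoE p1) -pnormE// poweR_EFin -pint_pnorm.
Qed.

(** A competitor contains the image of (1, 0), so its supremum is taken over a
nonempty set. *)
Lemma lambda2_ge0 : (0 <= lambda2 s p Omega)%E.
Proof.
apply: le_ereal_inf_tmp => _ [A [_ [h [hA _ _ _]]] <-].
have S10 : @S1 R (1, 0) by rewrite /S1/= expr1n expr0n addr0.
apply: (@le_trans _ _ (gagliardo s p (h (1, 0)%R) `^ p)%E); first exact: poweR_ge0.
by apply: ereal_sup_ubound; exists (h (1, 0)) => //; exact: hA.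
Qed.

Definition comb w1 w2 t : E -> R := fun x => t.1 * w1 x + t.2 * w2 x.

Section circle.
Variables w1 w2 : E -> R.
Hypotheses (W1 : W0 w1) (W2 : W0 w2).
Local Notation m t := (pnorm mu p (comb w1 w2 t)).

Let s1 := sobolev0_sobolev W1.
Let s2 := sobolev0_sobolev W2.
Let w1L := ((sobolevP p1 _).1 s1).1.
Let w2L := ((sobolevP p1 _).1 s2).1.
Let Qw1L := ((sobolevP p1 _).1 s1).2.
Let Qw2L := ((sobolevP p1 _).1 s2).2.

Let comb_lin3 t : comb w1 w2 t = lin3 w1 w2 w1 t.1 t.2 0.
Proof. by apply/funext => x; rewrite /comb /lin3 mul0r addr0. Qed.

Let Qcomb_lin3 t : Q (comb w1 w2 t) = lin3 (Q w1) (Q w2) (Q w1) t.1 t.2 0.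
Proof. by apply/funext => z; rewrite quo_lin /lin3 mul0r addr0. Qed.

Lemma sobolev0_comb t : W0 (comb w1 w2 t).
Proof. exact: sobolev0_lin. Qed.

Lemma pnorm_comb_cvg {J : Type} (F : set_system J) {FF : Filter F} (t_ : J -> R * R) t :
  t_ @ F --> t -> m (t_ i) @[i --> F] --> m t.
Proof.
move=> Ft; rewrite comb_lin3; under eq_fun do rewrite comb_lin3.
apply: pnorm_lin3_cvg => //; try exact: cvg_cst.
  exact: (cvg_comp _ _ Ft cvg_fst).
exact: (cvg_comp _ _ Ft cvg_snd).
Qed.

Lemma pint_comb_cvg {J : Type} (F : set_system J) {FF : Filter F} (t_ : J -> R * R) t :
  t_ @ F --> t ->
  pint mu p (comb w1 w2 (t_ i)) @[i --> F] --> pint mu p (comb w1 w2 t) /\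
  pint mu2 p (Q (comb w1 w2 (t_ i))) @[i --> F] --> pint mu2 p (Q (comb w1 w2 t)).
Proof.
move=> Ft.
have Ft1 : (t_ i).1 @[i --> F] --> t.1 by exact: (cvg_comp _ _ Ft cvg_fst).
have Ft2 : (t_ i).2 @[i --> F] --> t.2 by exact: (cvg_comp _ _ Ft cvg_snd).
split.
  rewrite comb_lin3; under eq_fun do rewrite comb_lin3.
  by apply: pint_lin3_cvg => //; exact: cvg_cst.
rewrite Qcomb_lin3; under eq_fun do rewrite Qcomb_lin3.
by apply: pint_lin3_cvg => //; exact: cvg_cst.
Qed.

(** Normalizing the unit circle of the plane spanned by w1 and w2 gives a
competitor for the second eigenvalue. *)
Lemma lambda2_le (c : R) : (forall t, S1 t -> 0 < m t) ->
  (forall t, S1 t -> pint mu2 p (Q (comb w1 w2 t)) <= c * pint mu p (comb w1 w2 t)) ->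
  (lambda2 s p Omega <= c%:E)%E.
Proof.
move=> m0 mc.
pose h t : E -> R := comb w1 w2 (t.1 / m t, t.2 / m t).
have hE t : h t = fun x => (m t)^-1 * comb w1 w2 t x.
  by apply/funext => x; rewrite /h /comb /=; ring.
have combL t : comb w1 w2 t \in Lfun mu p%:E.
  exact: ((sobolevP p1 _).1 (sobolev0_sobolev (sobolev0_comb t))).1.
have W0h t : W0 (h t) by exact: sobolev0_comb.
pose A := h @` (@S1 R).
apply: (@le_trans _ _ (ereal_sup [set (gagliardo s p u `^ p)%E | u in A])).
  apply: ereal_inf_lbound; exists A; last reflexivity.
  split.
    move=> _ [t St <-]; split; first exact: W0h.
    have hL : h t \in Lfun mu p%:E by exact: ((sobolevP p1 _).1 (sobolev0_sobolev (W0h t))).1.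
    rewrite -pnormE// hE pnormZ// gtr0_norm ?invr_gt0 ?m0//.
    by rewrite mulVf// gt_eqF// m0.
  exists h; split.
  - by move=> t St; exists t.
  - by move=> _ [t St <-]; exists t => //; exact: ae_eq_refl.
  - move=> t St; apply/nearW => x _.
    have mN : m (- t) = m t.
      rewrite (_ : comb w1 w2 (- t) = fun x => -1 * comb w1 w2 t x).
        by rewrite pnormZ// normrN1 mul1r.
      by apply/funext => x'; rewrite /comb /=; ring.
    by rewrite /h mN /comb /=; ring.
  - move=> t St; have sh t' := sobolev0_sobolev (W0h t').
    pose sd t' := snorm s p (fun x => h t' x - h t x).
    rewrite (_ : (fun t' => _) = fun t' => (sd t')%:E); last first.
      apply/funext => t'.
      exact: (snormE p1 _ (sobolevB p1 _ _ (sh t') (sh t))).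
    have mt : m t' @[t' --> within (@S1 R) (nbhs t)] --> m t.
      by apply: pnorm_comb_cvg; exact: cvg_within.
    have tw : id @ within (@S1 R) (nbhs t) --> t by exact: cvg_within.
    have mV : (m t')^-1 @[t' --> within (@S1 R) (nbhs t)] --> (m t)^-1.
      by apply: cvgV; rewrite ?gt_eqF ?m0.
    have c1 : t'.1 / m t' @[t' --> within (@S1 R) (nbhs t)] --> t.1 / m t.
      by apply: cvgM mV; exact: (cvg_comp _ _ tw cvg_fst).
    have c2 : t'.2 / m t' @[t' --> within (@S1 R) (nbhs t)] --> t.2 / m t.
      by apply: cvgM mV; exact: (cvg_comp _ _ tw cvg_snd).
    have nd (k : R) (k_ : R * R -> R) : k_ @ within (@S1 R) (nbhs t) --> k ->
        `|k_ i - k| @[i --> within (@S1 R) (nbhs t)] --> (0 : R).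
      move=> kk; rewrite -(normr0 R) -(subrr k).
      by apply: cvg_norm; apply: cvgB => //; exact: cvg_cst.
    apply: cvg_EFin; first exact: nearW.
    apply: (@squeeze_cvgr _ _ _ _ (fun=> 0) (fun t' =>
      `|t'.1 / m t' - t.1 / m t| * snorm s p w1 + `|t'.2 / m t' - t.2 / m t| * snorm s p w2)).
    + apply: nearW => t'; rewrite snorm_ge0/= /sd.
      rewrite (_ : (fun x => _) = fun x => (t'.1 / m t' - t.1 / m t) * w1 x +
        (t'.2 / m t' - t.2 / m t) * w2 x); first exact: snorm_lin_le.
      by apply/funext => x; rewrite /h /comb /=; ring.
    + exact: cvg_cst.
    + have -> : (0 : R) = 0 * snorm s p w1 + 0 * snorm s p w2 by ring.
      by apply: cvgD; (apply: cvgM; [exact: nd|exact: cvg_cst]).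
apply: ge_ereal_sup => _ [_ [t St <-] <-].
rewrite gagliardo_poweR; last exact: sobolev0_sobolev (W0h t).
rewrite lee_fin hE.
rewrite (_ : Q _ = fun z => (m t)^-1 * Q (comb w1 w2 t) z); last first.
  by apply/funext => z; rewrite /quo; ring.
rewrite pintZ//; last exact: ((sobolevP p1 _).1 (sobolev0_sobolev (sobolev0_comb t))).2.
apply: (@le_trans _ _ (`|(m t)^-1| `^ p * (c * pint mu p (comb w1 w2 t)))).
  by rewrite ler_wpM2l ?powR_ge0 ?mc.
have mt0 := m0 t St.
rewrite pint_pnorm// mulrCA -powRM ?normr_ge0 ?(ltW mt0)// gtr0_norm ?invr_gt0//.
by rewrite mulVf ?gt_eqF// powR1 mulr1.
Qed.

(** When the inequality is strict on the unit circle, compactness leaves room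
for a smaller constant. *)
Lemma lambda2_lt (c : R) :
  (forall t, S1 t -> pint mu2 p (Q (comb w1 w2 t)) < c * pint mu p (comb w1 w2 t)) ->
  (lambda2 s p Omega < c%:E)%E.
Proof.
move=> hc.
have pos (k : R) : (forall t, S1 t ->
    pint mu2 p (Q (comb w1 w2 t)) < k * pint mu p (comb w1 w2 t)) ->
    forall t, S1 t -> 0 < m t.
  move=> hk t St; rewrite lt0r pnorm_ge0 andbT.
  apply/eqP => m0; have := hk t St; rewrite (pint_pnorm p1 (comb _ _ _)) m0 powR0 ?gt_eqF//; last first.
    exact: lt_trans p1.
  by rewrite mulr0 ltNge pint_ge0.
have near_c : \forall k \near c^'-, @S1 R `<=` (fun t =>
    pint mu2 p (Q (comb w1 w2 t)) < k * pint mu p (comb w1 w2 t)).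
  apply: (compact_near_coveringP _).1 => //; first exact: compact_S1.
  move=> t St.
  have [f1 f2] := pint_comb_cvg (filter_prod (nbhs t) c^'-) fst t cvg_fst.
  have kc : x.2 @[x --> filter_prod (nbhs t) c^'-] --> c.
    by apply: cvg_trans cvg_snd _; exact: cvg_within.
  have D : pint mu2 p (Q (comb w1 w2 x.1)) - x.2 * pint mu p (comb w1 w2 x.1)
      @[x --> filter_prod (nbhs t) c^'-] -->
      pint mu2 p (Q (comb w1 w2 t)) - c * pint mu p (comb w1 w2 t).
    exact: (cvgB f2 (cvgM kc f1)).
  have lt0 : pint mu2 p (Q (comb w1 w2 t)) - c * pint mu p (comb w1 w2 t) < 0.
    by rewrite subr_lt0 hc.
  by apply: filterS (cvgr_lt _ D _ lt0) => x /=; rewrite subr_lt0.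
have [k [kc hk]] := filter_ex (filterI (nbhs_left_lt c) near_c).
apply: (@le_lt_trans _ _ k%:E); last by rewrite lte_fin.
apply: lambda2_le; first by apply: (pos k) => t /hk.
by move=> t /hk /ltW.
Qed.

End circle.
End lambda2.

Arguments comb {R N}.
Arguments gagliardo_poweR {R N s p}.
Arguments lambda2_ge0 {R N s p Omega}.
Arguments sobolev0_comb {R N s p Omega}.
Arguments lambda2_le {R N s p Omega}.
Arguments lambda2_lt {R N s p Omega}.

(** * Deforming a curve with a strict maximum *)

Section deformation.
Context (d1 d2 : measure_display) (T1 : measurableType d1) (T2 : measurableType d2).
Context (R : realType) (p : R).
Hypothesis p1 : 1 < p.
Variables (mu : {measure set T1 -> \bar R}) (nu : {measure set T2 -> \bar R}).
Variables (a b x : T1 -> R) (A B X : T2 -> R) (lam : R).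
Hypotheses (aL : a \in Lfun mu p%:E) (bL : b \in Lfun mu p%:E) (xL : x \in Lfun mu p%:E).
Hypotheses (AL : A \in Lfun nu p%:E) (BL : B \in Lfun nu p%:E) (XL : X \in Lfun nu p%:E).
Hypothesis lam0 : 0 <= lam.

Local Notation f al be ga := (pint nu p (lin3 A B X al be ga)).
Local Notation g al be ga := (pint mu p (lin3 a b x al be ga)).

Let G (al be ga : R) : R := f al be ga - lam * g al be ga.
(* H eta al be / eta bounds the slope of G at ga = 0 on steps up
to eta: f is compared with its forward difference, g with its backward one. *)
Let H (eta al be : R) : R :=
  (f al be eta - f al be 0) + lam * (g al be (- eta) - g al be 0).

Let p0 : 0 < p. Proof. exact: lt_trans p1. Qed.

Lemma lin3_step {d} {T : measurableType d} (u v w : T -> R) al be ga ep :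
  (fun z => lin3 u v w al be ga z + ep * w z) = lin3 u v w al be (ga + ep).
Proof. by apply/funext => z; rewrite /lin3; ring. Qed.

Lemma lin3_scale {d} {T : measurableType d} (u v w : T -> R) k al be ga :
  lin3 u v w (k * al) (k * be) (k * ga) = fun z => k * lin3 u v w al be ga z.
Proof. by apply/funext => z; rewrite /lin3; ring. Qed.

Let G_scale k al be ga : G (k * al) (k * be) (k * ga) = `|k| `^ p * G al be ga.
Proof.
rewrite /G !lin3_scale !pintZ//; try exact: Lfun_lin3.
by ring.
Qed.

Let G_cvg {J : Type} (F : set_system J) {FF : Filter F} (a_ b_ c_ : J -> R) al be ga :
  a_ @ F --> al -> b_ @ F --> be -> c_ @ F --> ga ->
  G (a_ i) (b_ i) (c_ i) @[i --> F] --> G al be ga.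
Proof.
move=> Fa Fb Fc; apply: cvgB; first exact: pint_lin3_cvg.
by apply: cvgM; [exact: cvg_cst|exact: pint_lin3_cvg].
Qed.

Let H_cvg {J : Type} (F : set_system J) {FF : Filter F} (a_ b_ : J -> R) eta al be :
  a_ @ F --> al -> b_ @ F --> be ->
  H eta (a_ i) (b_ i) @[i --> F] --> H eta al be.
Proof.
move=> Fa Fb; apply: cvgD.
  by apply: cvgB; apply: pint_lin3_cvg => //; exact: cvg_cst.
apply: cvgM; first exact: cvg_cst.
by apply: cvgB; apply: pint_lin3_cvg => //; exact: cvg_cst.
Qed.

Let combine (k f0 fe fh g0 ge gm gh : R) : fe <= f0 + k * (fh - f0) ->
  gm <= g0 + k * (gh - g0) -> g0 <= gm + 2^-1 * (ge - gm) ->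
  fe - lam * ge <= (f0 - lam * g0) + k * ((fh - f0) + lam * (gh - g0)).
Proof.
move=> hf; set q := k * (gh - g0) => hg hm.
have h2 : g0 - q <= ge by lra.
have h3 := ler_wpM2l lam0 h2.
have -> : k * ((fh - f0) + lam * (gh - g0)) = k * (fh - f0) + lam * q.
  by rewrite /q; ring.
move: h3; rewrite mulrBr; move: (k * (fh - f0)) (lam * q) hf => r1 r2; lra.
Qed.

Let G_convex e eta al be : 0 < e <= eta -> G al be e <= G al be 0 + e / eta * H eta al be.
Proof.
move=> /andP[e0 eeta]; have eta0 := lt_le_trans e0 eeta.
have hf : f al be e <= f al be 0 + e / eta * (f al be eta - f al be 0).
  have := pint_convex p1 (lin3 A B X al be 0) X e eta.
  by rewrite !lin3_step !add0r; apply=> //; [exact: Lfun_lin3|rewrite ltW].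
have hg : g al be (- e) <= g al be 0 + e / eta * (g al be (- eta) - g al be 0).
  have := pint_convex p1 (lin3 a b x al be 0) (fun z => -1 * x z) e eta.
  have stepN (ep : R) : (fun z => lin3 a b x al be 0 z + ep * (-1 * x z)) = lin3 a b x al be (- ep).
    by apply/funext => z; rewrite /lin3; ring.
  by rewrite !stepN; apply=> //; [exact: Lfun_lin3|exact: LfunZ|rewrite ltW].
(* the point 0 is the midpoint of - e and e *)
have hm : g al be 0 <= g al be (- e) + e / (e + e) * (g al be e - g al be (- e)).
  have := pint_convex p1 (lin3 a b x al be (- e)) x e (e + e).
  rewrite !lin3_step addNr addKr; apply=> //; first exact: Lfun_lin3.
    by rewrite (ltW e0) lerDl ltW.
  by rewrite addr_gt0.
have en0 : e != 0 by rewrite gt_eqF.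
have ee : e / (e + e) = 2^-1.
  by rewrite -mulr2n -[e *+ 2]mulr_natr invfM mulrA mulfV// mul1r.
rewrite ee in hm.
exact: combine hf hg hm.
Qed.

(** If f - lam g is nonpositive on the plane ga = 0, negative there off the
diagonal, and decreasing in the third direction at (1, 1, 0), then it is
negative on the unit circle pushed slightly in the third direction. The factor
(t.1 + t.2) / 2 keeps the pushed circle symmetric; by homogeneity it reduces
the points near the diagonal to those near (1, 1). *)
Lemma deform_circle_lt :
  (forall al be, f al be 0 <= lam * g al be 0) ->
  (forall al be, al != be -> f al be 0 < lam * g al be 0) ->
  (\int[nu]_z (dpow p (A z + B z) * X z) < lam * \int[mu]_z (dpow p (a z + b z) * x z))%R ->
  \forall e \near 0^'+, forall t, S1 t ->
    f t.1 t.2 (e * ((t.1 + t.2) / 2)) < lam * g t.1 t.2 (e * ((t.1 + t.2) / 2)).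
Proof.
move=> fg fg_lt der.
have G0 al be : G al be 0 <= 0 by rewrite /G subr_le0.
have Glt0 al be : al != be -> G al be 0 < 0 by rewrite /G subr_lt0; exact: fg_lt.
suff G_circle : \forall e \near 0^'+, @S1 R `<=` (fun t => G t.1 t.2 (e * ((t.1 + t.2) / 2)) < 0).
  by apply: filterS G_circle => e he t /he; rewrite /G subr_lt0.
have [eta eta0 Heta] : exists2 eta : R, 0 < eta & H eta 1 1 < 0.
  have fn := pint_derivative p1 (lin3 A B X 1 1 0) X (Lfun_lin3 p1 _ _ _ _ _ _ AL BL XL) XL.
  have xNL : (fun z => -1 * x z) \in Lfun mu p%:E by exact: LfunZ.
  have gn := pint_derivative p1 (lin3 a b x 1 1 0) _ (Lfun_lin3 p1 _ _ _ _ _ _ aL bL xL) xNL.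
  have abL : (fun z => a z + b z) \in Lfun mu p%:E by exact: LfunD.
  have E1 : (\int[nu]_z (dpow p (lin3 A B X 1 1 0 z) * X z) =
      \int[nu]_z (dpow p (A z + B z) * X z))%R.
    by congr (Rintegral _ _ _); apply/funext => z; rewrite /lin3 !mul1r mul0r addr0.
  have E2 : (\int[mu]_z (dpow p (lin3 a b x 1 1 0 z) * (-1 * x z)) =
      - \int[mu]_z (dpow p (a z + b z) * x z))%R.
    rewrite -[RHS]mulN1r -RintegralZl//; last exact: integrable_dpow.
    by congr (Rintegral _ _ _); apply/funext => z; rewrite /lin3 !mul1r mul0r addr0 mulrCA.
  have D : n.+1%:R * H n.+1%:R^-1 1 1 @[n --> \oo] -->
      p * (\int[nu]_z (dpow p (A z + B z) * X z) -
           lam * \int[mu]_z (dpow p (a z + b z) * x z))%R.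
    have -> : p * (\int[nu]_z (dpow p (A z + B z) * X z) -
           lam * \int[mu]_z (dpow p (a z + b z) * x z))%R =
        p * \int[nu]_z (dpow p (A z + B z) * X z) +
        lam * (p * - \int[mu]_z (dpow p (a z + b z) * x z)) by ring.
    rewrite -E1 -E2.
    have gE n : (fun z => lin3 a b x 1 1 0 z + n.+1%:R^-1 * (-1 * x z)) =
        lin3 a b x 1 1 (- n.+1%:R^-1) by apply/funext => z; rewrite /lin3; ring.
    rewrite (_ : (fun n => _) = (fun n =>
      n.+1%:R * (pint nu p (fun z => lin3 A B X 1 1 0 z + n.+1%:R^-1 * X z) - f 1 1 0) +
      lam * (n.+1%:R * (pint mu p (fun z => lin3 a b x 1 1 0 z + n.+1%:R^-1 * (-1 * x z)) -
        g 1 1 0)))).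
      by apply: cvgD fn _; apply: cvgM gn; exact: cvg_cst.
    by apply/funext => n; rewrite gE lin3_step add0r /H mulrDr mulrCA.
  have [n _ /(_ n (leqnn n)) hn] : \forall n \near \oo, n.+1%:R * H n.+1%:R^-1 1 1 < 0.
    by apply: (cvgr_lt _ D); rewrite pmulr_rlt0// subr_lt0.
  exists n.+1%:R^-1; first by rewrite invr_gt0.
  by move: hn; rewrite /= pmulr_rlt0.
apply: (compact_near_coveringP _).1; first exact: compact_S1.
move=> t St.
have c1 : z.1.1 @[z --> filter_prod (nbhs t) (0 : R)^'+] --> t.1.
  exact: (cvg_comp _ _ (@cvg_fst _ _ (nbhs t) (0 : R)^'+ _) (@cvg_fst _ _ (nbhs t.1) (nbhs t.2) _)).
have c2 : z.1.2 @[z --> filter_prod (nbhs t) (0 : R)^'+] --> t.2.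
  exact: (cvg_comp _ _ (@cvg_fst _ _ (nbhs t) (0 : R)^'+ _) (@cvg_snd _ _ (nbhs t.1) (nbhs t.2) _)).
have c3 : z.2 @[z --> filter_prod (nbhs t) (0 : R)^'+] --> (0 : R).
  by apply: cvg_trans cvg_snd _; exact: cvg_within.
have [tt|tt] := eqVneq t.1 t.2; last first.
  have D : G z.1.1 z.1.2 (z.2 * ((z.1.1 + z.1.2) / 2)) @[z --> filter_prod (nbhs t) (0 : R)^'+]
     --> G t.1 t.2 0.
    have D0 : z.2 * ((z.1.1 + z.1.2) / 2) @[z --> filter_prod (nbhs t) (0 : R)^'+]
        --> 0 * ((t.1 + t.2) / 2).
      by apply: cvgM => //; apply: cvgM; [exact: cvgD|exact: cvg_cst].
    by apply: G_cvg => //; rewrite mul0r in D0.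
  by apply: filterS (cvgr_lt _ D _ (Glt0 _ _ tt)).
have t10 : t.1 != 0.
  apply/eqP => t10; move: St; rewrite /S1/= -tt t10 expr0n addr0 => /eqP.
  by rewrite eq_sym oner_eq0.
(* homogeneity: dividing by tau moves the point near (1, 1, 0) *)
pose tau (z : (R * R) * R) : R := (z.1.1 + z.1.2) / 2.
have tauE : (t.1 + t.2) / 2 = t.1 by rewrite -tt; field.
have tau1 : tau z @[z --> filter_prod (nbhs t) (0 : R)^'+] --> t.1.
  by rewrite -[X in _ --> X]tauE; apply: cvgM; [exact: cvgD|exact: cvg_cst].
have HD : H eta (z.1.1 / tau z) (z.1.2 / tau z) @[z --> filter_prod (nbhs t) (0 : R)^'+] --> H eta 1 1.
  apply: H_cvg; rewrite -(mulfV t10).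
    by apply: cvgM => //; exact: cvgV.
  by apply: cvgM; [rewrite tt|exact: cvgV].
have tau_neq0 : \forall z \near filter_prod (nbhs t) (0 : R)^'+, tau z != 0.
  by move/cvgr_neq0 : tau1 => /(_ t10).
have e_small : \forall z \near filter_prod (nbhs t) (0 : R)^'+, 0 < z.2 <= eta.
  have es : \forall e \near (0 : R)^'+, 0 < e <= eta.
    by near=> e; apply/andP; split; [near: e; exact: nbhs_right_gt|near: e; exact: nbhs_right_le].
  exact: (@cvg_snd _ _ (nbhs t) (0 : R)^'+ _ _ es).
apply: filterS3 (cvgr_lt _ HD _ Heta) tau_neq0 e_small => z /= Hz tz ez.
have E1 : tau z * (z.1.1 / tau z) = z.1.1 by rewrite mulrC divfK.
have E2 : tau z * (z.1.2 / tau z) = z.1.2 by rewrite mulrC divfK.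
have := G_scale (tau z) (z.1.1 / tau z) (z.1.2 / tau z) z.2.
rewrite E1 E2 [tau z * z.2]mulrC => ->.
rewrite pmulr_rlt0; last by apply: powR_gt0; rewrite normr_gt0.
apply: le_lt_trans (G_convex _ _ _ _ ez) _.
rewrite -[ltRHS]addr0 ler_ltD// pmulr_rlt0// divr_gt0//.
by case/andP: ez.
Unshelve. all: by end_near.
Qed.

End deformation.

Arguments deform_circle_lt {d1 d2 T1 T2 R p} p1 {mu nu}.

(** * Positive and negative parts *)

Section parts.
Context (R : realType) (N : nat) (s p : R).
Hypothesis p1 : 1 < p.
Local Notation E := 'rV[R]_N.
Local Notation mu := (lebesgue_rV R N).
Local Notation mu2 := ((mu \x mu)%E : {measure set (E * E) -> \bar R}).
Local Notation Q := (quo s p).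
Implicit Types (u v xi : E -> R).

Let p0 : 0 < p. Proof. exact: lt_trans p1. Qed.
Let pn0 : p != 0. Proof. by rewrite gt_eqF. Qed.

(** The number <D[u]_p^p, xi> / p. *)
Definition denergy u xi : R := (\int[mu2]_z (dpow p (Q u z) * Q xi z))%R.

Lemma dgagliardoE u xi : sobolev s p u -> sobolev s p xi ->
  ((p^-1)%:E * dgagliardo s p u xi = (denergy u xi)%:E)%E.
Proof.
move=> /(sobolevP p1)[_ QuL] /(sobolevP p1)[_ QxL].
rewrite /dgagliardo muleA -EFinM mulVf// mul1e.
have i1 := integrable_dpow p1 _ _ QuL QxL.
rewrite /denergy /Rintegral fineK; last exact: (integrable_fin_num measurableT i1).
by apply: eq_integral => z _; rewrite quo_dpow.
Qed.

Lemma posnegE v x : pospart v x + negpart v x = v x.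
Proof. by rewrite /pospart /negpart; case: (leP (v x) 0) => ?; ring. Qed.

Lemma quo_posneg v z : Q v z = Q (pospart v) z + Q (negpart v) z.
Proof. by rewrite /quo -!(posnegE v); ring. Qed.

Lemma quo_posneg_ge0 v z : 0 <= Q (pospart v) z * Q (negpart v) z.
Proof.
rewrite /quo mulrACA mulr_ge0// -?expr2 ?sqr_ge0// /pospart /negpart.
by case: (leP (v z.1) 0) => ?; case: (leP (v z.2) 0) => ?; nra.
Qed.

Lemma quo_posneg_gt0 v z : 0 < v z.1 -> v z.2 < 0 ->
  0 < Q (pospart v) z * Q (negpart v) z.
Proof.
move=> v1 v2; have z12 : z.1 - z.2 != 0.
  apply/eqP => /eqP; rewrite subr_eq0 => /eqP z12.
  by move: v1; rewrite z12 ltNge ltW.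
rewrite /quo mulrACA mulr_gt0// -?expr2 ?exprn_even_gt0//=; last first.
  by rewrite invr_neq0// gt_eqF// powR_gt0// eucl_gt0.
rewrite /pospart /negpart.
by case: (leP (v z.1) 0) => ?; case: (leP (v z.2) 0) => ?; nra.
Qed.

(** The positive and the negative part have disjoint supports. *)
Lemma pint_comb_posneg v t : pospart v \in Lfun mu p%:E -> negpart v \in Lfun mu p%:E ->
  pint mu p (comb (pospart v) (negpart v) t) =
  `|t.1| `^ p * pint mu p (pospart v) + `|t.2| `^ p * pint mu p (negpart v).
Proof.
move=> aL bL; rewrite -!pintZ// /pint -RintegralD//; last 2 first.
  exact: (Lfun_pintegrable p1 _ (LfunZ p1 _ _ aL)).
  exact: (Lfun_pintegrable p1 _ (LfunZ p1 _ _ bL)).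
apply: eq_Rintegral => x _; rewrite /comb /pospart /negpart.
have n0 : `|0 : R| `^ p = 0 by rewrite normr0 powR0.
by case: (leP (v x) 0) => ?; rewrite !mulr0 ?addr0 ?add0r n0 ?addr0 ?add0r.
Qed.

Section jensen.
Variables (v : E -> R) (t : R * R).
Hypotheses (sa : sobolev s p (pospart v)) (sb : sobolev s p (negpart v)).
Local Notation a := (pospart v).
Local Notation b := (negpart v).

Let QaL := ((sobolevP p1 _).1 sa).2.
Let QbL := ((sobolevP p1 _).1 sb).2.

Let QvL : Q v \in Lfun mu2 p%:E.
Proof. by rewrite (funext (quo_posneg v)); exact: LfunD. Qed.

Let F z : R := `|t.1| `^ p * (dpow p (Q v z) * Q a z) +
               `|t.2| `^ p * (dpow p (Q v z) * Q b z).

Let ia := integrable_dpow p1 _ _ QvL QaL.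
Let ib := integrable_dpow p1 _ _ QvL QbL.
Let ka := integrableZl measurableT (`|t.1| `^ p) ia.
Let kb := integrableZl measurableT (`|t.2| `^ p) ib.

Let Fi : mu2.-integrable setT (EFin \o F).
Proof. exact: (integrableD measurableT ka kb). Qed.

Let denergyF : `|t.1| `^ p * denergy v a + `|t.2| `^ p * denergy v b =
  (\int[mu2]_z F z)%R.
Proof. by rewrite /denergy -!RintegralZl// -RintegralD. Qed.

Let FE z : F z = dpow p (Q a z + Q b z) * (`|t.1| `^ p * Q a z + `|t.2| `^ p * Q b z).
Proof. by rewrite /F (quo_posneg v); ring. Qed.

Let Qcomb z : Q (comb a b t) z = t.1 * Q a z + t.2 * Q b z.
Proof. by rewrite -quo_lin. Qed.

Let le_F z : `|Q (comb a b t) z| `^ p <= F z.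
Proof. by rewrite Qcomb FE; apply: jensen_dpow => //; exact: quo_posneg_ge0. Qed.

Let QcombL : Q (comb a b t) \in Lfun mu2 p%:E.
Proof. by rewrite (funext Qcomb); apply: LfunD => //; exact: LfunZ. Qed.

(** Jensen's inequality applied under the integral, where quo_posneg_ge0
provides the nonnegative weights. *)
Lemma pint_quo_comb_le : pint mu2 p (Q (comb a b t)) <=
  `|t.1| `^ p * denergy v a + `|t.2| `^ p * denergy v b.
Proof.
rewrite denergyF; apply: le_Rintegral => //.
exact: (Lfun_pintegrable p1 _ QcombL).
Qed.

(** The inequality is strict off the diagonal since the two truncations
interact: both differences are nonzero on {v > 0} x {v < 0}. *)
Lemma pint_quo_comb_lt : measurable_fun setT v ->
  (0 < mu [set x | (0 < v x)%R])%E -> (0 < mu [set x | (v x < 0)%R])%E -> t.1 != t.2 ->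
  pint mu2 p (Q (comb a b t)) <
  `|t.1| `^ p * denergy v a + `|t.2| `^ p * denergy v b.
Proof.
move=> mv vpos vneg tt; rewrite denergyF.
have m1 : measurable [set x | 0 < v x].
  by rewrite -[X in measurable X]setTI; exact: measurable_fun_ltr.
have m2 : measurable [set x | v x < 0].
  by rewrite -[X in measurable X]setTI; exact: measurable_fun_ltr.
apply: (lt_Rintegral _ _ ([set x | 0 < v x] `*` [set x | v x < 0])) => //.
- exact: (Lfun_pintegrable p1 _ QcombL).
- exact: measurableX.
- apply: (@lt_le_trans _ _ (mu [set x | (0 < v x)%R] * mu [set x | (v x < 0)%R])%E).
    exact: mule_gt0.
  by rewrite /= product_measure1E.
- move=> z [/= v1 v2]; rewrite Qcomb FE; apply: jensen_dpow_lt => //.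
  exact: quo_posneg_gt0.
Qed.

End jensen.

End parts.

Arguments denergy {R N}.
Arguments dgagliardoE {R N s p}.
Arguments posnegE {R N}.
Arguments quo_posneg {R N}.
Arguments pint_comb_posneg {R N p}.
Arguments pint_quo_comb_le {R N s p}.
Arguments pint_quo_comb_lt {R N s p}.

(** * The variational argument *)

Section variational.
Context (R : realType) (N : nat) (s p : R) (Omega : set 'rV[R]_N) (v : 'rV[R]_N -> R).
Hypotheses (p1 : 1 < p) (oO : open Omega) (W0v : sobolev0 s p Omega v).
Local Notation E := 'rV[R]_N.
Local Notation mu := (lebesgue_rV R N).
Local Notation mu2 := ((mu \x mu)%E : {measure set (E * E) -> \bar R}).
Local Notation Q := (quo s p).
Local Notation W0 := (sobolev0 s p Omega).
Local Notation a := (pospart v).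
Local Notation b := (negpart v).

Let p0 : 0 < p. Proof. exact: lt_trans p1. Qed.
Let pn0 : p != 0. Proof. by rewrite gt_eqF. Qed.

Lemma integral_Omega_pint (f : E -> R) : W0 f ->
  (\int[mu]_(x in Omega) (`|f x| `^ p)%:E = (pint mu p f)%:E)%E.
Proof.
move=> W0f; have [fL _] := (sobolevP p1 _).1 (sobolev0_sobolev W0f).
rewrite pintE//; apply: integral_outside; first exact: measurable_rV_open.
  by apply: measurable_norm_powR; exact: Lfun_measurable fL.
apply: filterS (sobolev0_outside p1 _ W0f) => x fx Ox.
by rewrite fx// normr0 powR0.
Qed.

(** The derivative of the p-th power of the norm of L^p at u, paired with xi and
divided by p. *)
Definition dmass (u xi : E -> R) : R := (\int[mu]_x (dpow p (u x) * xi x))%R.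

Lemma integral_Omega_dmass (u xi : E -> R) : W0 u -> W0 xi ->
  (\int[mu]_(x in Omega) (`|u x| `^ (p - 2) * u x * xi x)%:E = (dmass u xi)%:E)%E.
Proof.
move=> W0u W0x; have [uL _] := (sobolevP p1 _).1 (sobolev0_sobolev W0u).
have [xL _] := (sobolevP p1 _).1 (sobolev0_sobolev W0x).
have i1 := integrable_dpow p1 _ _ uL xL.
rewrite /dmass /Rintegral fineK; last exact: (integrable_fin_num measurableT i1).
apply: integral_outside; first exact: measurable_rV_open.
  by apply/measurable_EFinP; exact: measurable_int i1.
apply: filterS (sobolev0_outside p1 _ W0u) => x ux Ox.
by rewrite ux// mulr0 mul0r.
Qed.

Hypotheses (vpos : (0 < mu [set x | (0 < v x)%R])%E) (vneg : (0 < mu [set x | (v x < 0)%R])%E).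

Let W0a : W0 a. Proof. exact: sobolev0_pospart. Qed.
Let W0b : W0 b. Proof. exact: sobolev0_negpart. Qed.
Let sv := sobolev0_sobolev W0v.
Let sa := sobolev0_sobolev W0a.
Let sb := sobolev0_sobolev W0b.
Let vL := ((sobolevP p1 _).1 sv).1.
Let aL := ((sobolevP p1 _).1 sa).1.
Let bL := ((sobolevP p1 _).1 sb).1.
Let QaL := ((sobolevP p1 _).1 sa).2.
Let QbL := ((sobolevP p1 _).1 sb).2.
Let mv : measurable_fun setT v := Lfun_measurable _ vL.

Lemma pint_pospart_gt0 : 0 < pint mu p a.
Proof.
rewrite lt0r pint_ge0 andbT; apply/eqP => /(pint_eq0 p1 _ aL)[B [mB B0 sB]].
move: vpos; rewrite lt0e => /andP[/eqP + _]; apply.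
apply: (subset_measure0 _ mB _ B0).
  by rewrite -[X in measurable X]setTI; exact: measurable_fun_ltr.
move=> x /= vx; apply: sB => /=; rewrite /pospart max_l ?ltW// => h.
by move: vx; rewrite h ltxx.
Qed.

Lemma pint_negpart_gt0 : 0 < pint mu p b.
Proof.
rewrite lt0r pint_ge0 andbT; apply/eqP => /(pint_eq0 p1 _ bL)[B [mB B0 sB]].
move: vneg; rewrite lt0e => /andP[/eqP + _]; apply.
apply: (subset_measure0 _ mB _ B0).
  by rewrite -[X in measurable X]setTI; exact: measurable_fun_ltr.
move=> x /= vx; apply: sB => /=; rewrite /negpart min_l ?ltW// => h.
by move: vx; rewrite h ltxx.
Qed.

Local Notation A1 := (pint mu p a).
Local Notation A2 := (pint mu p b).
Local Notation J1 := (denergy s p v a).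
Local Notation J2 := (denergy s p v b).

Let combE t : pint mu p (comb a b t) = `|t.1| `^ p * A1 + `|t.2| `^ p * A2.
Proof. exact: pint_comb_posneg. Qed.

Let S1_neq0 (t : R * R) : S1 t -> (t.1 != 0) || (t.2 != 0).
Proof.
rewrite /S1 /= => h; apply/norP => -[/negPn/eqP t1 /negPn/eqP t2].
by move: h; rewrite t1 t2 expr0n addr0 => /eqP; rewrite eq_sym oner_eq0.
Qed.

Let weights_gt0 (x y A B : R) : 0 < A -> 0 < B -> (x != 0) || (y != 0) ->
  0 < `|x| `^ p * A + `|y| `^ p * B.
Proof.
move=> A0 B0 xy.
have h1 : 0 <= `|x| `^ p * A by apply: mulr_ge0; [exact: powR_ge0|exact: ltW].
have h2 : 0 <= `|y| `^ p * B by apply: mulr_ge0; [exact: powR_ge0|exact: ltW].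
have /orP[t0|t0] := xy.
  apply: ltr_pwDl => //; apply: mulr_gt0 => //.
  by apply: powR_gt0; rewrite normr_gt0.
apply: ltr_pwDr => //; apply: mulr_gt0 => //.
by apply: powR_gt0; rewrite normr_gt0.
Qed.

Let weights_le (x y J K A B c : R) : J <= c * A -> K <= c * B ->
  `|x| `^ p * J + `|y| `^ p * K <= c * (`|x| `^ p * A + `|y| `^ p * B).
Proof.
move=> JA KB; rewrite mulrDr !(mulrCA c); apply: lerD; rewrite ler_wpM2l//; exact: powR_ge0.
Qed.

Let weights_lt (x J K A B c : R) : x != 0 -> J + K < c * A + c * B ->
  `|x| `^ p * J + `|x| `^ p * K < c * (`|x| `^ p * A + `|x| `^ p * B).
Proof.
move=> x0 JK.
have -> : c * (`|x| `^ p * A + `|x| `^ p * B) = `|x| `^ p * (c * A + c * B) by ring.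
rewrite -mulrDr ltr_pM2l//.
by apply: powR_gt0; rewrite normr_gt0.
Qed.

Let quotient_bounds (J K A B : R) : 0 < A -> 0 < B ->
  J <= (`|J| / A + `|K| / B) * A /\ K <= (`|J| / A + `|K| / B) * B.
Proof.
move=> A0 B0; split.
  rewrite mulrDl divfK ?gt_eqF// (le_trans (ler_norm _))// lerDl.
  by apply: mulr_ge0; [apply: divr_ge0|]; rewrite ?normr_ge0 ?(ltW A0) ?(ltW B0).
rewrite mulrDl [X in _ + X]divfK ?gt_eqF// (le_trans (ler_norm _))// lerDr.
by apply: mulr_ge0; [apply: divr_ge0|]; rewrite ?normr_ge0 ?(ltW A0) ?(ltW B0).
Qed.

Let comb_gt0 t : S1 t -> 0 < pint mu p (comb a b t).
Proof.
move=> St; rewrite combE.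
exact: weights_gt0 pint_pospart_gt0 pint_negpart_gt0 (S1_neq0 t St).
Qed.

(** The circle of the truncations is a competitor of finite energy. *)
Lemma lambda2_fin_num : (lambda2 s p Omega \is a fin_num)%E.
Proof.
rewrite ge0_fin_numE ?lambda2_ge0//.
have [J1c J2c] := quotient_bounds J1 J2 A1 A2 pint_pospart_gt0 pint_negpart_gt0.
set c := _ + _ in J1c J2c.
apply: (@le_lt_trans _ _ c%:E); last exact: ltry.
apply: (lambda2_le p1 a b W0a W0b) => t St.
  rewrite lt0r pnorm_ge0 andbT; apply/eqP => m0.
  by move: (comb_gt0 t St); rewrite pint_pnorm// m0 powR0// ltxx.
apply: le_trans (pint_quo_comb_le p1 _ _ sa sb) _.
by rewrite combE; exact: (weights_le _ _ _ _ _ _ _ J1c J2c).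
Qed.

Local Notation lam := (fine (lambda2 s p Omega)).

Let lamE : (lambda2 s p Omega = lam%:E)%E.
Proof. by rewrite fineK// lambda2_fin_num. Qed.

Hypotheses (J1_le : J1 <= lam * A1) (J2_le : J2 <= lam * A2).

Let comb_le t : pint mu2 p (Q (comb a b t)) <= lam * pint mu p (comb a b t).
Proof.
apply: le_trans (pint_quo_comb_le p1 _ _ sa sb) _.
by rewrite combE; exact: (weights_le _ _ _ _ _ _ _ J1_le J2_le).
Qed.

Let comb_lt t : t.1 != t.2 -> pint mu2 p (Q (comb a b t)) < lam * pint mu p (comb a b t).
Proof.
move=> tt; apply: lt_le_trans (pint_quo_comb_lt p1 _ _ sa sb mv vpos vneg tt) _.
by rewrite combE; exact: (weights_le _ _ _ _ _ _ _ J1_le J2_le).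
Qed.

(** No circle of competitors stays strictly below the second eigenvalue. *)
Let lambda2_optimal w1 w2 : W0 w1 -> W0 w2 ->
  ~ (forall t, S1 t -> pint mu2 p (Q (comb w1 w2 t)) < lam * pint mu p (comb w1 w2 t)).
Proof.
by move=> W1 W2 /(lambda2_lt p1 w1 w2 W1 W2 lam); rewrite lamE ltxx.
Qed.

(** If one inequality were strict, so would be the estimate at the points with
t.1 = t.2, and the whole circle would stay below the second eigenvalue. *)
Lemma energy_eq : J1 = lam * A1 /\ J2 = lam * A2.
Proof.
have strict : J1 + J2 < lam * A1 + lam * A2 -> False.
  move=> lt12; apply: (lambda2_optimal a b W0a W0b) => t St.
  have [tt|tt] := eqVneq t.1 t.2; last exact: comb_lt.
  apply: le_lt_trans (pint_quo_comb_le p1 _ _ sa sb) _.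
  have t0 : t.1 != 0 by have := S1_neq0 t St; rewrite -tt orbb.
  by rewrite combE -tt; exact: (weights_lt _ _ _ _ _ _ t0 lt12).
split; apply: le_anti; apply/andP; split; [exact: J1_le| |exact: J2_le|].
  by rewrite leNgt; apply/negP => h; apply: strict; exact: ltr_leD h J2_le.
by rewrite leNgt; apply/negP => h; apply: strict; exact: ler_ltD J1_le h.
Qed.

(** A direction along which the energy decreases faster than the mass would
push the circle through v below the second eigenvalue. *)
Lemma dmass_le_denergy xi : W0 xi -> lam * dmass v xi <= denergy s p v xi.
Proof.
move=> W0x; rewrite leNgt; apply/negP => lt_xi.
have [xL QxL] := (sobolevP p1 _).1 (sobolev0_sobolev W0x).
have lam0 : 0 <= lam by rewrite fine_ge0// lambda2_ge0.
have c3 al be : lin3 a b xi al be 0 = comb a b (al, be).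
  by apply/funext => x; rewrite /lin3 /comb mul0r addr0.
have Q3 al be : lin3 (Q a) (Q b) (Q xi) al be 0 = Q (comb a b (al, be)).
  by apply/funext => z; rewrite /lin3 mul0r addr0 quo_lin.
have : \forall e \near 0^'+, forall t, S1 t ->
    pint mu2 p (lin3 (Q a) (Q b) (Q xi) t.1 t.2 (e * ((t.1 + t.2) / 2))) <
    lam * pint mu p (lin3 a b xi t.1 t.2 (e * ((t.1 + t.2) / 2))).
  apply: (deform_circle_lt p1 a b xi (Q a) (Q b) (Q xi) lam aL bL xL QaL QbL QxL lam0).
  - by move=> al be; rewrite c3 Q3; exact: comb_le.
  - by move=> al be albe; rewrite c3 Q3; exact: comb_lt.
  - rewrite (_ : (fun z => dpow p (Q a z + Q b z) * Q xi z) = fun z => dpow p (Q v z) * Q xi z); last first.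
      by apply/funext => z; rewrite -quo_posneg.
    rewrite (_ : (fun z => dpow p (a z + b z) * xi z) = fun z => dpow p (v z) * xi z)//.
    by apply/funext => z; rewrite posnegE.
move=> /(@filter_ex _ _ (at_right_proper_filter (0 : R)))[e he].
have W1 : W0 (fun x => 1 * a x + (e / 2) * xi x) by exact: sobolev0_lin.
have W2 : W0 (fun x => 1 * b x + (e / 2) * xi x) by exact: sobolev0_lin.
apply: (lambda2_optimal _ _ W1 W2) => t St.
have cE : comb (fun x => 1 * a x + (e / 2) * xi x) (fun x => 1 * b x + (e / 2) * xi x) t =
    lin3 a b xi t.1 t.2 (e * ((t.1 + t.2) / 2)).
  by apply/funext => x; rewrite /comb /lin3; ring.
have QE : Q (lin3 a b xi t.1 t.2 (e * ((t.1 + t.2) / 2))) =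
    lin3 (Q a) (Q b) (Q xi) t.1 t.2 (e * ((t.1 + t.2) / 2)).
  by apply/funext => z; rewrite /quo /lin3; ring.
by rewrite cE QE; exact: he.
Qed.

(** Both sides are odd in xi, so the inequality for xi and - xi is an equality. *)
Lemma denergy_eq_dmass xi : W0 xi -> denergy s p v xi = lam * dmass v xi.
Proof.
move=> W0x; apply/eqP; rewrite eq_le dmass_le_denergy// andbT.
have [xL QxL] := (sobolevP p1 _).1 (sobolev0_sobolev W0x).
have QvL := ((sobolevP p1 _).1 sv).2.
have := dmass_le_denergy _ (sobolev0_lin p1 (-1) 0 _ _ W0x W0x).
have -> : denergy s p v (fun x => -1 * xi x + 0 * xi x) = - denergy s p v xi.
  rewrite -[RHS]mulN1r /denergy -RintegralZl//; last exact: (integrable_dpow p1 _ _ QvL QxL).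
  by congr (Rintegral _ _ _); apply/funext => z; rewrite quo_lin; ring.
have -> : dmass v (fun x => -1 * xi x + 0 * xi x) = - dmass v xi.
  rewrite -[RHS]mulN1r /dmass -RintegralZl//; last exact: (integrable_dpow p1 _ _ vL xL).
  by congr (Rintegral _ _ _); apply/funext => z; ring.
by rewrite mulrN lerN2.
Qed.

End variational.


Arguments integral_Omega_pint {R N s p Omega}.
Arguments dmass {R N}.
Arguments integral_Omega_dmass {R N s p Omega}.
Arguments lambda2_fin_num {R N s p Omega v}.
Arguments energy_eq {R N s p Omega v}.
Arguments denergy_eq_dmass {R N s p Omega v}.

Theorem proposition3p1 (R : realType) (N : nat) (s p : R)
    (Omega : set 'rV[R]_N) (v : 'rV[R]_N -> R) :
  (1 <= N)%N -> 0 < s < 1 -> 1 < p ->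
  open Omega -> bounded_set Omega ->
  sobolev0 s p Omega v ->
  ~ (pospart v = cst 0 %[ae lebesgue_rV R N in Omega]) ->
  ~ (negpart v = cst 0 %[ae lebesgue_rV R N in Omega]) ->
  (lambda2 s p Omega *
     \int[lebesgue_rV R N]_(x in Omega) (`|pospart v x| `^ p)%:E >=
   (p^-1)%:E * dgagliardo s p v (pospart v))%E ->
  (lambda2 s p Omega *
     \int[lebesgue_rV R N]_(x in Omega) (`|negpart v x| `^ p)%:E >=
   (p^-1)%:E * dgagliardo s p v (negpart v))%E ->
  [/\ second_eigenfunction s p Omega v,
      (lambda2 s p Omega *
         \int[lebesgue_rV R N]_(x in Omega) (`|pospart v x| `^ p)%:E =
       (p^-1)%:E * dgagliardo s p v (pospart v))%E &
      (lambda2 s p Omega *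
         \int[lebesgue_rV R N]_(x in Omega) (`|negpart v x| `^ p)%:E =
       (p^-1)%:E * dgagliardo s p v (negpart v))%E].
Proof.
move=> _ _ p1 oO _ W0v a_neq0 b_neq0 Ha Hb.
have W0a := sobolev0_pospart p1 v W0v.
have W0b := sobolev0_negpart p1 v W0v.
have sv := sobolev0_sobolev W0v.
have sa := sobolev0_sobolev W0a.
have sb := sobolev0_sobolev W0b.
have mv := Lfun_measurable _ ((sobolevP p1 _).1 sv).1.
have vpos : (0 < lebesgue_rV R N [set x | (0 < v x)%R])%E.
  rewrite lt0e measure_ge0 andbT; apply/eqP => m0; apply: a_neq0.
  apply: (ae_eq0_of_measure0 _ _ _ m0) => [|x /negP]; last first.
    by rewrite -leNgt => vx; rewrite /pospart max_r.
  by rewrite -[X in measurable X]setTI; exact: measurable_fun_ltr.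
have vneg : (0 < lebesgue_rV R N [set x | (v x < 0)%R])%E.
  rewrite lt0e measure_ge0 andbT; apply/eqP => m0; apply: b_neq0.
  apply: (ae_eq0_of_measure0 _ _ _ m0) => [|x /negP]; last first.
    by rewrite -leNgt => vx; rewrite /negpart min_r.
  by rewrite -[X in measurable X]setTI; exact: measurable_fun_ltr.
have lamE := fineK (lambda2_fin_num p1 W0v vpos vneg).
rewrite -lamE (integral_Omega_pint p1 oO _ W0a) (dgagliardoE p1 _ _ sv sa) -EFinM lee_fin in Ha.
rewrite -lamE (integral_Omega_pint p1 oO _ W0b) (dgagliardoE p1 _ _ sv sb) -EFinM lee_fin in Hb.
have [Ea Eb] := energy_eq p1 W0v vpos vneg Ha Hb.
split; last 2 first.
- by rewrite -lamE (integral_Omega_pint p1 oO _ W0a) (dgagliardoE p1 _ _ sv sa) Ea EFinM.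
- by rewrite -lamE (integral_Omega_pint p1 oO _ W0b) (dgagliardoE p1 _ _ sv sb) Eb EFinM.
split; first exact: W0v.
- move=> v0; apply: a_neq0; apply: filterS v0 => x /(_ Logic.I) vx _.
  by rewrite /pospart vx maxxx.
- move=> xi W0x; have sx := sobolev0_sobolev W0x.
  rewrite -lamE (integral_Omega_dmass p1 oO _ _ W0v W0x) (dgagliardoE p1 _ _ sv sx).
  by rewrite (denergy_eq_dmass p1 W0v vpos vneg Ha Hb _ W0x) EFinM.
Qed.
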